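(* There exists a universal constant $C>0$ such that the following holds for all integers $n\ge 2$, $m\ge 1$. Let $$f(z,\bar z)=\sum_{|\alpha|=|\beta|=m}c_{\alpha\beta}\,z^\alpha\bar z^\beta,\qquad z\in\mathbb{C}^n,\ c_{\alpha\beta}\in\mathbb{C},$$ be a bi-homogeneous form of degree $m$ on $\mathbb{C}^n$ such that $f(z,\bar z)>0$ for all $z\neq 0$. Define $$\lambda(f):=\min_{\|z\|=1}f(z,\bar z),\qquad \Lambda(f):=\left(\sum_{|\alpha|=|\beta|=m}\frac{\alpha!\,\beta!}{m!^2}\,|c_{\alpha\beta}|^2\right)^{1/2}.$$ Then for every integer $N$ satisfying $$N\ \ge\ C\,\frac{\Lambda(f)}{\lambda(f)}\,(m+n)^3(\log n)^3$$ there exist homogeneous polynomials $P_1^N,\dots,P_{d_N}^N$ of degree $m+N$ in $z\in\mathbb{C}^n$ such that $$\|z\|^{2N}f(z,\bar z)=\sum_{j=1}^{d_N}|P_j^N(z)|^2\qquad\text{for all } z\in\mathbb{C}^n,$$ where $d_N$ is the dimension of the space of homogeneous polynomials of degree $m+N$ on $\mathbb{C}^n$.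
   Context: Here $\alpha=(\alpha_1,\dots,\alpha_n)\in\mathbb{N}^n$ (with $0\in\mathbb{N}$) is a multi-index, $|\alpha|=\alpha_1+\dots+\alpha_n$, $\alpha!=\alpha_1!\cdots\alpha_n!$, $z^\alpha=z_1^{\alpha_1}\cdots z_n^{\alpha_n}$, and $\|z\|^2=\sum_{j=1}^n|z_j|^2$. Polynomials $P_j^N$ are holomorphic polynomials with complex coefficients. ''Universal constant'' means that $C$ does not depend on $n$, $m$, $f$ or $N$. *)

(* Defs.v *)
From HB Require Import structures.
From mathcomp Require Import all_boot all_order all_algebra.
From mathcomp Require Import all_classical all_reals all_analysis.
From mathcomp Require Import complex.
(* The notations of [mpoly] are incompatible with those of MathComp-Analysis. *)
From mathcomp Require Import -(notations) mpoly.
Set Implicit Arguments.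
Unset Strict Implicit.
Unset Printing Implicit Defensive.
Import Order.TTheory GRing.Theory Num.Theory.
Import numFieldNormedType.Exports.
Local Open Scope classical_set_scope.
Local Open Scope ring_scope.

Definition mfact n (a : multinom n) : nat := (\prod_(i < n) (a i)`!)%N.

(* Euclidean norm; the library norm on row vectors is the sup norm. *)
Definition hnorm (R : realType) n (z : 'rV[R[i]]_n) : R :=
  Num.sqrt (\sum_(j < n) Normc.normc (z 0 j) ^+ 2).

(* [multinom n] is infinite: the sums range over the finite type of the
   multi-indices of degree < m.+1, filtered by degree. Only the coefficients
   c a b with |a| = |b| = m matter. *)
Definition biform (R : realType) n (m : nat)
    (c : multinom n -> multinom n -> R[i]) (z : 'rV[R[i]]_n) : R[i] :=
  \sum_(a : bmultinom n m.+1 | mdeg a == m)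
    \sum_(b : bmultinom n m.+1 | mdeg b == m)
      c a b * mmap1 (fun j => z 0 j) a * mmap1 (fun j => (z 0 j)^*%C) b.

(* The real part is harmless: this is used for real-valued forms. The infimum
   is a minimum, see [biform_min_attained]. *)
Definition biform_min (R : realType) n (m : nat)
    (c : multinom n -> multinom n -> R[i]) : R :=
  inf [set complex.Re (biform m c z) | z in [set z | hnorm z = 1]].

Definition biform_norm (R : realType) n (m : nat)
    (c : multinom n -> multinom n -> R[i]) : R :=
  Num.sqrt
    (\sum_(a : bmultinom n m.+1 | mdeg a == m)
       \sum_(b : bmultinom n m.+1 | mdeg b == m)
         ((mfact a)%:R * (mfact b)%:R / (m`!)%:R ^+ 2)
         * Normc.normc (c a b) ^+ 2).

(* The library equips [dhomog n F d] with a vector space structure only when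
   n is a successor; in no variables, only the constants are homogeneous. *)
Definition homog_dim (F : fieldType) (n d : nat) : nat :=
  match n with
  | 0 => (d == 0)%N
  | k.+1 => \dim {: dhomog k.+1 F d}
  end.

Lemma homog_dimE (F : fieldType) (n d : nat) :
  homog_dim F n.+1 d = 'C(d + n, d).
Proof. by rewrite /homog_dim dimvf. Qed.

Section Attained.
Context (R : realType) (n m : nat) (c : multinom n -> multinom n -> R[i]).

Let T : topologicalType := ('rV[R]_n * 'rV[R]_n)%type.
Let toC (p : T) : 'rV[R[i]]_n := \row_j (p.1 0 j +i* p.2 0 j)%C.
Let ctsC (g : T -> R[i]) :=
  continuous (fun p => complex.Re (g p)) /\
  continuous (fun p => complex.Im (g p)).

Let ctsC_cst (x : R[i]) : ctsC (fun=> x).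
Proof. by split; move=> p; exact: cvg_cst. Qed.

Let ctsC_add g h : ctsC g -> ctsC h -> ctsC (fun p => g p + h p).
Proof.
move=> [g1 g2] [h1 h2]; split=> p.
- rewrite (_ : (fun _ => _) =
    (fun p => complex.Re (g p) + complex.Re (h p))); last first.
    by apply/funext => q; case: (g q) => ? ?; case: (h q).
  exact: (cvgD (g1 p) (h1 p)).
- rewrite (_ : (fun _ => _) =
    (fun p => complex.Im (g p) + complex.Im (h p))); last first.
    by apply/funext => q; case: (g q) => ? ?; case: (h q).
  exact: (cvgD (g2 p) (h2 p)).
Qed.

Let ctsC_mul g h : ctsC g -> ctsC h -> ctsC (fun p => g p * h p).
Proof.
move=> [g1 g2] [h1 h2]; split=> p.
- rewrite (_ : (fun _ => _) = (fun p => complex.Re (g p) * complex.Re (h p)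
    - complex.Im (g p) * complex.Im (h p))); last first.
    by apply/funext => q; case: (g q) => ? ?; case: (h q).
  exact: (cvgB (cvgM (g1 p) (h1 p)) (cvgM (g2 p) (h2 p))).
- rewrite (_ : (fun _ => _) = (fun p => complex.Re (g p) * complex.Im (h p)
    + complex.Im (g p) * complex.Re (h p))); last first.
    by apply/funext => q; case: (g q) => ? ?; case: (h q).
  exact: (cvgD (cvgM (g1 p) (h2 p)) (cvgM (g2 p) (h1 p))).
Qed.

Let ctsC_sum (I : finType) (P : pred I) (F : I -> T -> R[i]) :
  (forall i, ctsC (F i)) -> ctsC (fun p => \sum_(i | P i) F i p).
Proof.
move=> cF; elim: (index_enum I) => [|i s ih].
  rewrite (_ : (fun _ => _) = fun=> 0); first exact: ctsC_cst.
  by apply/funext => p; rewrite big_nil.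
rewrite (_ : (fun _ => _) = fun p => (if P i then F i p else 0) +
    \sum_(j <- s | P j) F j p); last first.
  by apply/funext => p; rewrite big_cons; case: ifP; rewrite ?add0r.
by apply: ctsC_add => //; case: (P i); [exact: cF|exact: ctsC_cst].
Qed.

Let ctsC_mmap1 (h : 'I_n -> T -> R[i]) (a : multinom n) :
  (forall j, ctsC (h j)) -> ctsC (fun p => mmap1 (fun j => h j p) a).
Proof.
move=> ch; rewrite /mmap1; elim: (index_enum _) => [|i s ih].
  rewrite (_ : (fun _ => _) = fun=> 1); first exact: ctsC_cst.
  by apply/funext => p; rewrite big_nil.
rewrite (_ : (fun _ => _) = fun p => h i p ^+ a i *
    \prod_(j <- s) h j p ^+ a j); last first.
  by apply/funext => p; rewrite big_cons.
apply: ctsC_mul => //; elim: (a i) => [|k ihk].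
  by rewrite (_ : (fun _ => _) = fun=> 1) //; exact: ctsC_cst.
rewrite (_ : (fun _ => _) = fun p => h i p * h i p ^+ k).
  exact: ctsC_mul.
by apply/funext => p; rewrite exprS.
Qed.

Let coord1 j : continuous (fun p : T => p.1 0 j).
Proof.
by move=> p; apply: (cvg_comp fst (fun v : 'rV[R]_n => v 0 j));
  [exact: cvg_fst|exact: coord_continuous].
Qed.

Let coord2 j : continuous (fun p : T => p.2 0 j).
Proof.
by move=> p; apply: (cvg_comp snd (fun v : 'rV[R]_n => v 0 j));
  [exact: cvg_snd|exact: coord_continuous].
Qed.

Let ctsC_coord j : ctsC (fun p => toC p 0 j).
Proof.
split.
- by rewrite (_ : (fun _ => _) = fun p : T => p.1 0 j);
    [exact: coord1|apply/funext => p; rewrite mxE].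
- by rewrite (_ : (fun _ => _) = fun p : T => p.2 0 j);
    [exact: coord2|apply/funext => p; rewrite mxE].
Qed.

Let ctsC_conj j : ctsC (fun p => (toC p 0 j)^*%C).
Proof.
split.
- by rewrite (_ : (fun _ => _) = fun p : T => p.1 0 j);
    [exact: coord1|apply/funext => p; rewrite mxE].
- rewrite (_ : (fun _ => _) = fun p : T => - p.2 0 j).
    by move=> p; apply: cvgN; exact: coord2.
  by apply/funext => p; rewrite mxE.
Qed.

Let cts_biform : continuous (fun p => complex.Re (biform m c (toC p))).
Proof.
suff: ctsC (fun p => biform m c (toC p)) by case.
rewrite /biform; apply: ctsC_sum => a; apply: ctsC_sum => b.
apply: ctsC_mul; first apply: ctsC_mul; first exact: ctsC_cst.
- by apply: ctsC_mmap1 => j; exact: ctsC_coord.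
- by apply: ctsC_mmap1 => j; exact: ctsC_conj.
Qed.

Let sqn (p : T) : R := \sum_j (p.1 0 j ^+ 2 + p.2 0 j ^+ 2).

Let sqn_ge0 p : 0 <= sqn p.
Proof. by apply: sumr_ge0 => j _; rewrite addr_ge0 ?sqr_ge0. Qed.

Let hnorm_toC p : hnorm (toC p) = Num.sqrt (sqn p).
Proof.
rewrite /hnorm; congr Num.sqrt; apply: eq_bigr => j _.
by rewrite mxE /= sqr_sqrtr // addr_ge0 ?sqr_ge0.
Qed.

Let hnorm1 p : hnorm (toC p) = 1 <-> sqn p = 1.
Proof.
rewrite hnorm_toC; split=> [h|->]; last exact: sqrtr1.
by rewrite -[LHS]sqr_sqrtr // h expr1n.
Qed.

Let cts_sqn : continuous sqn.
Proof.
have -> : sqn = fun p => complex.Re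
    (\sum_j (toC p 0 j * (toC p 0 j)^*%C)).
  apply/funext => p; rewrite /sqn raddf_sum; apply: eq_bigr => j _.
  by rewrite mxE /= mulrN opprK -!expr2.
suff: ctsC (fun p => \sum_j (toC p 0 j * (toC p 0 j)^*%C)) by case.
apply: ctsC_sum => j; apply: ctsC_mul; [exact: ctsC_coord|exact: ctsC_conj].
Qed.

Let S : set T := [set p | sqn p = 1].
Let cube : set 'rV[R]_n := [set v | forall i, `[-1, 1]%classic (v 0 i)].

Let compactS : compact S.
Proof.
have cc : compact cube.
  apply: (@rV_compact R n (fun=> `[-1, 1]%classic)) => i.
  exact: segment_compact.
apply: (@subclosed_compact _ S (cube `*` cube)).
- exact: (proj1 (continuous_closedP sqn) cts_sqn _ (@closed_eq R 1)).
- exact: compact_setX.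
- have sq_itv (x : R) : x ^+ 2 <= 1 -> `[-1, 1]%classic x.
    by rewrite -[X in _ <= X](expr1n _ 2) => h; rewrite /= in_itv /= -ler_norml
      -(ler_pXn2r (n := 2)) ?nnegrE // real_normK ?num_real.
  have le_sqn (p : T) j : p.1 0 j ^+ 2 + p.2 0 j ^+ 2 <= sqn p.
    by rewrite /sqn (bigD1 j) //= lerDl sumr_ge0 // => i _;
      rewrite addr_ge0 ?sqr_ge0.
  move=> p Sp; split=> j; apply: sq_itv; rewrite -Sp;
    apply: le_trans (le_sqn p j).
  + by rewrite lerDl sqr_ge0.
  + by rewrite lerDr sqr_ge0.
Qed.

Lemma biform_min_attained : (0 < n)%N ->
  (exists2 z : 'rV[R[i]]_n, hnorm z = 1 &
     complex.Re (biform m c z) = biform_min m c) /\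
  (forall z : 'rV[R[i]]_n, hnorm z = 1 ->
     biform_min m c <= complex.Re (biform m c z)).
Proof.
move=> n0.
have S0 : S !=set0.
  pose j0 := Ordinal n0; exists (\row_j (j == j0)%:R, 0) => /=.
  rewrite /S /= /sqn (bigD1 j0) //= !mxE eqxx expr1n expr0n addr0 big1 ?addr0 //.
  by move=> i /negbTE ij; rewrite !mxE ij expr0n addr0.
have [p] := compact_EVT_min S0 compactS (continuous_subspaceT cts_biform).
rewrite inE => Sp pmin.
have zmin z : hnorm z = 1 ->
    complex.Re (biform m c (toC p)) <= complex.Re (biform m c z).
  pose q : T := (map_mx (@complex.Re R) z, map_mx (@complex.Im R) z).
  have <- : toC q = z.
    by apply/rowP => j; rewrite !mxE /=; case: (z 0 j).
  by move=> /hnorm1 Sq; apply: pmin; rewrite inE.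
have hp : hnorm (toC p) = 1 by apply/hnorm1.
suff eqp : complex.Re (biform m c (toC p)) = biform_min m c.
  by split; [exists (toC p)|rewrite -eqp].
apply/eqP; rewrite eq_le; apply/andP; split.
- apply: lb_le_inf; first by exists (complex.Re (biform m c (toC p))), (toC p).
  by move=> _ [z hz <-]; exact: zmin.
- apply: ge_inf; last by exists (toC p).
  by exists (complex.Re (biform m c (toC p))) => _ [z hz <-]; exact: zmin.
Qed.

End Attained.

(* Main.v *)
(** On holomorphic [g] of degree [m + N], the Gram matrix of
    [|z|^(2N) f] is, up to [N!], the Wick (normally ordered) quantisation of [f]
    on the Fock space with inner product [int u conj(v) exp(-|z|^2)].  Reordering
    turns it into an alternating sum, over multi-indices [kappa], of the anti-Wick
    quantisations of the contractions [h_kappa] of [f], that is of the integrals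
    [int h_kappa |g|^2 exp(-|z|^2)].  Positivity of the integral gives at least
    [lambda s] for [kappa = 0], where [s = int |z|^(2m) |g|^2 exp(-|z|^2)], while
    Cauchy-Schwarz bounds [|h_kappa|] by [Lambda m^(2|kappa|) |z|^(2(m-|kappa|))], and each
    factor [|z|^2] lost costs a factor [N] in the integral.  So the terms with
    [kappa <> 0] add up to at most [2 Lambda n m^2 / N] times [s], and the Gram matrix is
    positive semidefinite as soon as [N >= 2 (Lambda / lambda) n m^2]; as
    [n m^2 <= (m + n)^3] and [ln n >= ln 2], [C = 2 / (ln 2)^3] suffices.  The Gaussian
    integral, normalised to mass 1, enters only through its moments
    [int z^a conj(z)^b = delta_ab a!]. *)

Require Import Defs.
From HB Require Import structures.
From mathcomp Require Import all_boot all_order all_algebra.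
From mathcomp Require Import all_classical all_reals all_analysis.
From mathcomp Require Import complex polyrcf separable cyclic cyclotomic.
From mathcomp Require Import -(notations) mpoly.
From mathcomp Require Import ring lra zify.
Set Implicit Arguments.
Unset Strict Implicit.
Unset Printing Implicit Defensive.
Import Order.TTheory GRing.Theory Num.Theory.
Local Open Scope ring_scope.

(** * Roots of unity and positivity of Gaussian moments *)

(** In characteristic 0 the polynomial X^k - 1 is separable, so it has [k] distinct roots; among [k]
    distinct [k]-th roots of unity one is primitive. *)
Lemma exists_prim_root (F : numClosedFieldType) (k : nat) :
  (0 < k)%N -> exists w : F, k.-primitive_root w.
Proof.
move=> k0; pose p : {poly F} := 'X^k - 1.
have [r Dp] := closed_field_poly_normal p.
have Hp : p = \prod_(z <- r) ('X - z%:P).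
  by rewrite {1}Dp (monicP _) ?scale1r// monicXnsubC.
have rn1 : all k.-unity_root r by apply/allP=> z; rewrite -root_prod_XsubC -Hp.
have sz_r : (k < (size r).+1)%N.
  by rewrite -(size_prod_XsubC r id) -Hp size_XnsubC.
have [|w ? ?] := hasP (has_prim_root k0 rn1 _ sz_r); last by exists w.
by rewrite -separable_prod_XsubC -Hp separable_Xn_sub_1 // pnatr_eq0 -lt0n.
Qed.

(** Supplies the index set of the Gram matrix; its size is later matched with [homog_dim]. *)
Lemma homog_monomials (n d : nat) : exists B : seq (multinom n.+1),
  [/\ uniq B, size B = 'C(d + n, d) & forall a, (a \in B) = (mdeg a == d)].
Proof.
eexists; split; [exact: uniq_basis|exact: size_basis|].
by move=> a; rewrite basis_cover.
Qed.

(* [q = p + p' + p'' + ...] satisfies [q - q' = p], so [e^-t q] decreases, and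
   [q 0] is the factorial moment of [p]. *)
Lemma factorial_moment_ge0 (R : realType) (p : {poly R}) (d : nat) :
  (size p <= d)%N -> (forall t, 0 <= t -> 0 <= p.[t]) ->
  0 <= \sum_(k < d) p`_k * k`!%:R.
Proof.
move=> sp p_ge0; have [p0|p0] := eqVneq p 0.
  by rewrite big1 // => k _; rewrite p0 coef0 mul0r.
have lc_gt0 : 0 < lead_coef p.
  rewrite lt_neqAle eq_sym lead_coef_eq0 p0 /= leNgt; apply/negP => lc_lt0.
  have [|t0 Ht0] := @poly_pinfty_gt_lc _ (- p).
    by rewrite lead_coefN oppr_gt0.
  have := Ht0 (Num.max t0 0); rewrite le_max lexx => /(_ isT).
  rewrite hornerN lead_coefN lerN2 => h.
  have := le_trans (p_ge0 (Num.max t0 0) _) h.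
  by rewrite le_max lexx orbT leNgt lc_lt0 => /(_ isT).
pose q := \sum_(i < d) p^`(i).
have qE : q - q^`() = p.
  have -> : q^`() = \sum_(i < d) p^`(i.+1).
    by rewrite /q raddf_sum /=; apply: eq_bigr.
  rewrite /q -sumrB.
  have -> : \sum_(i < d) (p^`(i) - p^`(i.+1)) = p^`(0) - p^`(d).
    elim: d {sp q} => [|d IH]; first by rewrite big_ord0 subrr.
    by rewrite big_ord_recr /= IH addrA subrK.
  by rewrite derivn0 derivn_poly0 // subr0.
have q0 : q.[0] = \sum_(k < d) p`_k * k`!%:R.
  rewrite /q horner_sum; apply: eq_bigr => i _.
  by rewrite horner_coef0 coef_derivn addn0 ffactnn mulr_natr.
(* As q' has smaller size, [q] inherits the positive leading coefficient of [p]. So [q] is positive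
   at some large [T'], and the decrease of [f] carries this sign back to 0. *)
have lcq_gt0 : 0 < lead_coef q.
  suff -> : lead_coef q = lead_coef p by [].
  have sq' : (size q^`() < size q)%N.
    rewrite lt_size_deriv //; apply: contraNneq p0 => q_eq0.
    by rewrite -qE q_eq0 deriv0 subr0.
  by rewrite -qE lead_coefDl // size_polyN.
have [T HT] := poly_pinfty_gt_lc lcq_gt0.
pose T' := Num.max T 0.
have qT : 0 < q.[T'] by apply: lt_le_trans lcq_gt0 (HT _ _); rewrite le_max lexx.
pose f (t : R) : R := expR (- t) * q.[t].
have df (t : R) : is_derive t 1 f (- expR (- t) * p.[t]).
  have h1 : is_derive t 1 (fun t : R => expR (- t)) (- expR (- t)).
    have hN : is_derive t (1 : R) (fun t : R => - t) (- 1).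
      by apply: is_deriveN; exact: is_derive_id.
    have := @is_derive1_comp R expR (fun t : R => - t) t _ _ (is_derive_expR _) hN.
    by rewrite mulrN1.
  have h2 := is_deriveM h1 (is_derive_poly q t).
  apply: (is_derive_eq h2).
  rewrite -[in RHS]qE hornerD hornerN /GRing.scale /=; ring.
have f0T : f T' <= f 0.
  apply: (@ler0_derive1_nincr _ f 0 T') => //; rewrite ?le_max ?lexx ?orbT //.
  - move=> x; rewrite in_itv /= => /andP[x0 _].
    rewrite derive1E derive_val mulNr oppr_le0 mulr_ge0 ?expR_ge0 //.
    by apply: p_ge0; rewrite ltW.
  - by apply: derivable_within_continuous => x _.
move: f0T; rewrite /f oppr0 expR0 mul1r q0; apply: le_trans.
by rewrite mulr_ge0 ?expR_ge0 // ltW.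
Qed.

(** A geometric sum of ratio [th]. Since w^* is the inverse of [w], [th] is 1 exactly when [k = l],
    both being below [K]; otherwise [th ^+ K = 1] makes the sum vanish. *)
Lemma sum_prim_root (F : numClosedFieldType) (K k l : nat) (w : F) :
  K.-primitive_root w -> (k < K)%N -> (l < K)%N ->
  \sum_(a < K) (w ^+ a) ^+ k * ((w ^+ a)^* ) ^+ l = K%:R * (k == l)%:R.
Proof.
move=> pw kK lK; have K0 := prim_order_gt0 pw.
have nw : `|w| = 1.
  apply/eqP; rewrite -(@pexpr_eq1 _ _ K) ?normr_ge0 // -normrX.
  by rewrite prim_expr_order // normr1.
have ww : w * w^* = 1 by rewrite -normCK nw expr1n.
pose th := w ^+ k * (w^* ) ^+ l.
rewrite (eq_bigr (fun a : 'I_K => th ^+ a)); last first.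
  by move=> a _; rewrite rmorphXn /= -!exprM exprMn -!exprM !(mulnC (nat_of_ord a)).
have [kl|kl] := eqVneq k l.
  rewrite (eq_bigr (fun=> 1)) ?sumr_const ?card_ord ?mulr1 // => a _.
  by rewrite /th kl -exprMn ww !expr1n.
have th1 : th - 1 != 0.
  rewrite subr_eq0; apply: contra_neq kl => th1.
  have : w ^+ k = w ^+ l.
    have := congr1 (fun x => x * w ^+ l) th1.
    by rewrite /th -mulrA -exprMn mulrC (mulrC w^* ) ww expr1n !mul1r.
  by move=> /eqP; rewrite (eq_prim_root_expr pw) !modn_small // => /eqP.
rewrite mulr0; apply: (mulfI th1); rewrite -subrX1 mulr0 /th.
have wcK : (w^* ) ^+ K = 1 by rewrite -(rmorphXn Num.conj) /= (prim_expr_order pw) conjC1.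
rewrite exprMn -!exprM !(mulnC _ K) !exprM wcK (prim_expr_order pw).
by rewrite !expr1n mulr1 subrr.
Qed.

(* Averaging over rotations by roots of unity keeps only the terms [k i = l i],
   which form a polynomial in [|x|^2]. *)
Lemma gauss_moment1_ge0 (R : realType) (I : eqType) (r : seq I) (c : I -> R[i])
    (k l : I -> nat) :
  (forall x : R[i],
     0 <= complex.Re (\sum_(i <- r) c i * (x ^+ k i * (x^*%C) ^+ l i))) ->
  0 <= complex.Re (\sum_(i <- r) c i * ((k i == l i)%:R * (k i)`!%:R)).
Proof.
(* [K] exceeds all exponents, so that equality modulo [K] is equality. *)
move=> Hx; pose K := (\max_(i <- r) (k i + l i)).+1.
have leK i : i \in r -> (k i < K)%N /\ (l i < K)%N.
  move=> ir; rewrite !ltnS.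
  have h : (k i + l i <= \max_(i <- r) (k i + l i))%N by exact: leq_bigmax_seq.
  by split; apply: leq_trans h; rewrite ?leq_addr ?leq_addl.
have [w pw] := @exists_prim_root R[i] K isT.
pose p := \poly_(j < K) \sum_(i <- r | (k i == l i) && (k i == j)) complex.Re (c i).
have pick (F : nat -> R) : \sum_(j < K)
    (\sum_(i <- r | (k i == l i) && (k i == j)) complex.Re (c i)) * F j =
    complex.Re (\sum_(i <- r) c i * ((k i == l i)%:R * (F (k i))%:C%C)).
  rewrite raddf_sum /=.
  transitivity (\sum_(j < K) \sum_(i <- r)
      if (k i == l i) && (k i == j) then complex.Re (c i) * F j else 0).
    by apply: eq_bigr => j _; rewrite mulr_suml -big_mkcond.
  rewrite exchange_big; apply: eq_big_seq => i ir.
  case: (k i == l i); last by rewrite big1 // mul0r mulr0.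
  rewrite (bigD1 (Ordinal (leK i ir).1)) //= eqxx big1 ?addr0 ?mul1r.
    by case: (c i) => x y /=; rewrite mulr0 subr0.
  by move=> j; rewrite -val_eqE /= eq_sym => /negbTE ->.
have p_ge0 t : 0 <= t -> 0 <= p.[t].
  move=> t0; rewrite horner_poly pick.
  pose s : R[i] := (Num.sqrt t)%:C%C.
  have ss : s * s^* = t%:C%C.
    by rewrite -[s^*]/(s^*%C) conjc_real -rmorphM /= -expr2 sqr_sqrtr.
  have : 0 <= complex.Re (\sum_(a < K) \sum_(i <- r)
      c i * ((s * w ^+ a) ^+ k i * ((s * w ^+ a)^*%C) ^+ l i)).
    by rewrite raddf_sum; apply: sumr_ge0 => a _; exact: Hx.
  rewrite exchange_big /=.
  have -> : \sum_(i <- r) \sum_(a < K)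
      c i * ((s * w ^+ a) ^+ k i * ((s * w ^+ a)^*%C) ^+ l i) =
      K%:R%:C%C * \sum_(i <- r) c i * ((k i == l i)%:R * (t ^+ k i)%:C%C).
    rewrite mulr_sumr; apply: eq_big_seq => i /leK[kK lK].
    have sE := sum_prim_root pw kK lK.
    rewrite -mulr_sumr mulrCA; congr (_ * _).
    transitivity (s ^+ k i * (s^* ) ^+ l i *
        \sum_(a < K) (w ^+ a) ^+ k i * ((w ^+ a)^* ) ^+ l i).
      rewrite mulr_sumr; apply: eq_bigr => a _.
      rewrite -[_^*%C]/((s * w ^+ a)^* ) rmorphM !exprMn; ring.
    rewrite sE mulrCA rmorph_nat; congr (_ * _).
    case: eqP => [->|_]; last by rewrite mulr0 mul0r.
    by rewrite mulr1 mul1r -exprMn ss rmorphXn.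
  case: (\sum_(i <- r) _) => x y /=; rewrite mul0r subr0.
  by rewrite pmulr_rge0 // ltr0n.
(* Since |x|^(2j) has Gaussian moment j!, the factorial moment of [p] is the Gaussian moment of the
   original sum. *)
have := factorial_moment_ge0 (size_poly _ _ : (size p <= K)%N) p_ge0.
rewrite (eq_bigr (fun j : 'I_K => (\sum_(i <- r | (k i == l i) && (k i == j))
   complex.Re (c i)) * (j`!)%:R)); last by move=> j _; rewrite coef_poly ltn_ord.
rewrite (pick (fun j => (j`!)%:R)); congr (0 <= complex.Re _).
by apply: eq_bigr => i _; rewrite rmorph_nat.
Qed.

(** Integrates one variable at a time: in [wt d] the first [d] variables are already replaced by
    their moments and the others are evaluated at [z]. Each step is the one-variable case with the
    other factors absorbed into the coefficients. *)
Lemma gauss_moment_ge0 (R : realType) (n : nat) (I : eqType) (r : seq I)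
    (c : I -> R[i]) (a b : I -> multinom n) :
  (forall z : 'I_n -> R[i], 0 <= complex.Re (\sum_(i <- r)
     c i * (mmap1 z (a i) * mmap1 (fun j => (z j)^*%C) (b i)))) ->
  0 <= complex.Re (\sum_(i <- r) c i * ((a i == b i)%:R * (mfact (a i))%:R)).
Proof.
move=> Hz.
pose wt (d : nat) (z : 'I_n -> R[i]) (i : I) (j : 'I_n) : R[i] :=
  if (j < d)%N then (a i j == b i j)%:R * (a i j)`!%:R
  else z j ^+ a i j * ((z j)^*%C) ^+ b i j.
have step d : (d <= n)%N -> forall z,
    0 <= complex.Re (\sum_(i <- r) c i * \prod_(j < n) wt d z i j).
  elim: d => [_|d IH dn] z.
    have := Hz z; congr (0 <= complex.Re _); apply: eq_bigr => i _.
    by rewrite /mmap1 -big_split.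
  pose j0 := Ordinal dn.
  have := @gauss_moment1_ge0 R I r
    (fun i => c i * \prod_(j < n | j != j0) wt d.+1 z i j)
    (fun i => a i j0) (fun i => b i j0).
  have E i : \prod_(j < n) wt d.+1 z i j =
      (\prod_(j < n | j != j0) wt d.+1 z i j) *
      ((a i j0 == b i j0)%:R * (a i j0)`!%:R).
    by rewrite (bigD1 j0) //= mulrC {2}/wt /= ltnSn.
  have -> : \sum_(i <- r) c i * \prod_(j < n) wt d.+1 z i j = \sum_(i <- r)
      c i * (\prod_(j < n | j != j0) wt d.+1 z i j) *
      ((a i j0 == b i j0)%:R * (a i j0)`!%:R).
    by apply: eq_bigr => i _; rewrite E mulrA.
  apply => x.
  have := IH (ltnW dn) (fun j => if j == j0 then x else z j).
  congr (0 <= complex.Re _); apply: eq_bigr => i _.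
  rewrite -mulrA; congr (_ * _); rewrite (bigD1 j0) //= mulrC; congr (_ * _).
    apply: eq_bigr => j jj0; rewrite /wt (negbTE jj0) ltnS.
    by rewrite [in RHS]leq_eqVlt -[X in X || _]/(j == j0) (negbTE jj0).
  by rewrite /wt ltnn eqxx.
have := step n (leqnn n) (fun=> 0); congr (0 <= complex.Re _).
apply: eq_bigr => i _; congr (_ * _).
under eq_bigr do rewrite /wt ltn_ord.
rewrite big_split -!natr_prod; congr (_%:R * _%:R).
have [->|ab] := eqVneq (a i) (b i).
  by rewrite big1 // => j _; rewrite eqxx.
have [j jab] : exists j, a i j != b i j.
  apply/existsP; rewrite -negb_forall; apply: contra ab => /forallP h.
  by apply/eqP/mnmP => j; apply/eqP.
by rewrite (bigD1 j) //= (negbTE jab) mul0n.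
Qed.

(** * The Fock inner product *)

Lemma mmap1D (n : nat) (S : comNzRingType) (h : 'I_n -> S) (a b : multinom n) :
  mmap1 h (mnm_add a b) = mmap1 h a * mmap1 h b.
Proof. by apply: commr_mmap1_M => i x; exact: mulrC. Qed.

(* The inner product of [z^a g] and [z^b g] for the Gaussian weight
   [exp (-|z|^2)], where [g] has coefficients [g u], [u] in [B]. *)
Definition fock (R : realType) (n : nat) (B : seq (multinom n))
    (g : multinom n -> R[i]) (a b : multinom n) : R[i] :=
  \sum_(u <- B) \sum_(v <- B) g u * (g v)^*%C *
    ((mnm_add a u == mnm_add b v)%:R * (mfact (mnm_add a u))%N%:R).

Lemma mmap1_conj (R : realType) (n : nat) (z : 'I_n -> R[i]) (a : multinom n) :
  mmap1 (fun j => (z j)^*%C) a = (mmap1 z a)^*%C.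
Proof.
rewrite /mmap1 rmorph_prod; apply: eq_bigr => j _; by rewrite rmorphXn.
Qed.

(** A pointwise nonnegative form stays so after multiplication by |G|^2, where [G] is the polynomial
    with coefficients [g]; the Gaussian moment of the product is the sum of Fock products. *)
Lemma fock_ge0 (R : realType) (n : nat) (B : seq (multinom n))
    (g : multinom n -> R[i]) (I : eqType) (r : seq I)
    (c : I -> R[i]) (a b : I -> multinom n) :
  (forall z : 'I_n -> R[i], 0 <= complex.Re (\sum_(i <- r)
     c i * (mmap1 z (a i) * mmap1 (fun j => (z j)^*%C) (b i)))) ->
  0 <= complex.Re (\sum_(i <- r) c i * fock B g (a i) (b i)).
Proof.
move=> Hz.
pose s := [seq (i, uv) | i <- r, uv <- [seq (u, v) | u <- B, v <- B]].
have := @gauss_moment_ge0 R n _ s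
  (fun t => c t.1 * (g t.2.1 * (g t.2.2)^*%C))
  (fun t => mnm_add (a t.1) t.2.1) (fun t => mnm_add (b t.1) t.2.2).
have sE (F : I * (multinom n * multinom n) -> R[i]) :
    \sum_(t <- s) F t = \sum_(i <- r) \sum_(u <- B) \sum_(v <- B) F (i, (u, v)).
  rewrite big_allpairs_dep; apply: eq_bigr => i _.
  by rewrite big_allpairs_dep.
rewrite !sE.
have -> : \sum_(i <- r) c i * fock B g (a i) (b i) = \sum_(i <- r) \sum_(u <- B)
    \sum_(v <- B) c i * (g u * (g v)^*%C) *
      ((mnm_add (a i) u == mnm_add (b i) v)%:R * (mfact (mnm_add (a i) u))%:R).
  apply: eq_bigr => i _; rewrite /fock mulr_sumr; apply: eq_bigr => u _.
  by rewrite mulr_sumr; apply: eq_bigr => v _; rewrite mulrA.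
apply => z; rewrite sE.
pose G := \sum_(u <- B) g u * mmap1 z u.
have -> : \sum_(i <- r) \sum_(u <- B) \sum_(v <- B)
    c i * (g u * (g v)^*%C) * (mmap1 z (mnm_add (a i) u) *
      mmap1 (fun j => (z j)^*%C) (mnm_add (b i) v)) =
    (\sum_(i <- r) c i * (mmap1 z (a i) * mmap1 (fun j => (z j)^*%C) (b i))) *
    (G * G^*%C).
  rewrite mulr_suml; apply: eq_bigr => i _.
  rewrite /G mulr_suml mulr_sumr; apply: eq_bigr => u _.
  rewrite rmorph_sum mulr_sumr mulr_sumr; apply: eq_bigr => v _.
  rewrite !mmap1D !mmap1_conj rmorphM /=; ring.
have := Hz z; case: (\sum_(i <- r) _) => x y /= x0.
case: G => p q /=; rewrite [X in _ <= X](_ : _ = x * (p ^+ 2 + q ^+ 2)); last by ring.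
by rewrite mulr_ge0 // addr_ge0 ?sqr_ge0.
Qed.

(** * Words and multinomial coefficients *)

(* The monomials of the expanded power [(z_1 + ... + z_n)^p], with repetition. *)
Fixpoint words (n p : nat) : seq (multinom n) :=
  if p is p'.+1 then
    [seq mnm_add (mnm1 j) w | j <- enum 'I_n, w <- words n p']
  else [:: mnm0].

Lemma big_wordsS (V : nmodType) (n p : nat) (F : multinom n -> V) :
  \sum_(w <- words n p.+1) F w =
  \sum_(j < n) \sum_(w <- words n p) F (mnm_add (mnm1 j) w).
Proof. by rewrite big_allpairs_dep big_enum. Qed.

Lemma mdeg_words (n p : nat) (w : multinom n) : w \in words n p -> mdeg w = p.
Proof.
elim: p w => [|p IH] w; first by rewrite inE => /eqP ->; rewrite mdeg0.
by case/allpairsP=> -[j w'] /= [_ /IH wp ->]; rewrite mdegD mdeg1 wp.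
Qed.

Lemma sum_mmap1_words (S : comNzRingType) (n p : nat) (h : 'I_n -> S) :
  \sum_(w <- words n p) mmap1 h w = (\sum_(j < n) h j) ^+ p.
Proof.
elim: p => [|p IH]; first by rewrite big_seq1 mmap11 expr0.
rewrite big_wordsS exprS mulr_suml; apply: eq_bigr => j _.
by rewrite -IH mulr_sumr; apply: eq_bigr => w _; rewrite mmap1D mmap1U.
Qed.

Lemma mfact0 (n : nat) : mfact (@mnm0 n) = 1%N.
Proof. by rewrite /mfact big1 // => i _; rewrite mnm0E. Qed.

Lemma mfact_gt0 (n : nat) (a : multinom n) : (0 < mfact a)%N.
Proof. by rewrite prodn_gt0 // => i; exact: fact_gt0. Qed.

Lemma mfactU (n : nat) (j : 'I_n) (a : multinom n) :
  mfact (mnm_add (mnm1 j) a) = ((a j).+1 * mfact a)%N.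
Proof.
rewrite /mfact (bigD1 j) //= [in RHS](bigD1 j) //= mulnA; congr (_ * _)%N.
  by rewrite mnmDE mnm1E eqxx add1n factS.
by apply: eq_bigr => i ij; rewrite mnmDE mnm1E eq_sym (negbTE ij).
Qed.

(** The multinomial coefficient, free of division. By induction, the words with first letter [j]
    account for [a j] times [p!], and the [a j] add up to the degree. *)
Lemma count_words (n p : nat) (a : multinom n) :
  mdeg a = p -> (count_mem a (words n p) * mfact a)%N = p`!.
Proof.
elim: p a => [|p IH] a.
  by move/eqP; rewrite mdeg_eq0 => /eqP ->; rewrite /= eqxx mfact0.
move=> ap; rewrite -sum1_count big_mkcond big_wordsS big_distrl /=.
transitivity (\sum_(j < n) a j * p`!)%N; last first.
  by rewrite -big_distrl -mdegE ap factS.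
apply: eq_bigr => j _; case aj : (a j) => [|k].
  rewrite big1 // => w _; case: eqP => // wa.
  by move: aj; rewrite -wa mnmDE mnm1E eqxx.
have aE : a = mnm_add (mnm1 j) (mnm_sub a (mnm1 j)).
  by rewrite addmC submK // lep1mP aj.
have dp : mdeg (mnm_sub a (mnm1 j)) = p.
  by apply/succn_inj; rewrite -ap [in RHS]aE mdegD mdeg1.
rewrite -(IH _ dp) [in LHS]aE mfactU mnmBE mnm1E eqxx aj subn1 mulnCA -sum1_count.
rewrite [in RHS]big_mkcond; congr (_ * (_ * _))%N; apply: eq_bigr => w _.
by rewrite /= eqm_add2l.
Qed.

(** Multiplying |z^a|^2 by |z|^(2p) scales its Gaussian integral by a rising factorial: a further
    letter [j] multiplies the factorial by [a j + 1], and these factors sum to [mdeg a + n]. *)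
Lemma sum_mfact_words (n p : nat) (a : multinom n) :
  (\sum_(w <- words n p) mfact (mnm_add w a) =
   mfact a * \prod_(i < p) (mdeg a + n + i))%N.
Proof.
elim: p a => [|p IH] a; first by rewrite big_seq1 add0m big_ord0 muln1.
rewrite big_wordsS.
transitivity (\sum_(j < n) ((a j).+1 * mfact a *
    \prod_(i < p) (mdeg a + n + i.+1)))%N.
  apply: eq_bigr => j _; rewrite -mfactU.
  under eq_bigr do rewrite (addmC (mnm1 j)) -addmA.
  rewrite IH; congr (_ * _)%N; apply: eq_bigr => i _.
  by rewrite mdegD mdeg1; lia.
have aS : (\sum_(j < n) (a j).+1 = mdeg a + n)%N.
  under eq_bigr do rewrite -addn1.
  by rewrite big_split /= -mdegE sum1_card card_ord.
by rewrite -big_distrl -big_distrl /= big_ord_recl /= addn0 aS mulnCA mulnA.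
Qed.

(** * Reordering: from normal order to anti-normal order *)

(** By Pascal's rule, raising [b] by one amounts to replacing [F] by its finite difference. *)
Lemma alt_bin_rec (A : comNzRingType) (b : nat) (F : nat -> A) :
  \sum_(k < b.+2) (-1) ^+ k * 'C(b.+1, k)%:R * F k =
  \sum_(k < b.+1) (-1) ^+ k * 'C(b, k)%:R * (F k - F k.+1).
Proof.
under [RHS]eq_bigr do rewrite mulrBr.
rewrite sumrB big_ord_recl /= [in RHS]big_ord_recl /= !bin0 -addrA; congr (_ + _).
rewrite (eq_bigr (fun k : 'I_b.+1 =>
   (-1) ^+ k.+1 * 'C(b, k.+1)%:R * F k.+1 - (-1) ^+ k * 'C(b, k)%:R * F k.+1)).
  by rewrite sumrB big_ord_recr /= bin_small // mulr0 mul0r addr0.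
by move=> k _; rewrite /bump /= add1n binS natrD exprS; ring.
Qed.

(** An iterated finite difference of binomials: each step lowers [s] and [r] by one. The factor
    [(b <= r)] supplies the zero that the truncated [r - b] would miss. *)
Lemma alt_bin_sum (A : comNzRingType) (b s r : nat) : (b <= s)%N ->
  \sum_(k < b.+1) (-1) ^+ k * 'C(b, k)%:R * 'C(s - k, r)%:R =
  ('C(s - b, r - b) * (b <= r))%N%:R :> A.
Proof.
elim: b s r => [|b IH] s r bs.
  by rewrite big_ord1 expr0 bin0 !subn0 muln1 !mul1r.
rewrite (@alt_bin_rec A b (fun k => 'C(s - k, r)%:R)).
case: s bs => // s; rewrite ltnS => bs.
case: r => [|r].
  by rewrite ltn0 muln0 big1 // => k _; rewrite !bin0 subrr mulr0.
rewrite subSS subSS ltnS -IH //; apply: eq_bigr => k _; congr (_ * _).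
rewrite subSS subSn ?binS ?natrD; last by have := ltn_ord k; lia.
by rewrite addrAC subrr add0r.
Qed.

(** The right-hand side is the one-variable Fock product of the [b]-th derivative of z^u and the
    [a]-th derivative of z^v; the left-hand side uses products of z^(a-k+u) and z^(b-k+v) only. Once
    a! u! is pulled out, this is [alt_bin_sum] with [s = a + u] and [r = u]. *)
Lemma wick_coord (A : comNzRingType) (K a b u v : nat) :
  (a < K)%N -> (b < K)%N ->
  \sum_(k < K) (-1) ^+ k * (k`! * ('C(a, k) * 'C(b, k)))%N%:R *
    ((a - k + u == b - k + v) * (a - k + u)`!)%N%:R =
  ((a + u == b + v) * (v`! * u ^_ b))%N%:R :> A.
Proof.
move=> aK bK.
rewrite (eq_bigr (fun k : 'I_K => if (k < b.+1)%N then
   (a + u == b + v)%:R * ((a`! * u`!)%N%:R * ((-1) ^+ k * 'C(b, k)%:R * 'C(a + u - k, u)%:R)) else 0)).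
  rewrite -big_mkcond -(big_ord_widen K (fun k =>
   (a + u == b + v)%:R * ((a`! * u`!)%N%:R * ((-1) ^+ k * 'C(b, k)%:R * 'C(a + u - k, u)%:R)))) //.
  rewrite -!mulr_sumr natrM; have [auv|_] := eqVneq (a + u)%N (b + v)%N; last by rewrite !mul0r.
  rewrite alt_bin_sum; last by rewrite auv leq_addr.
  rewrite -!natrM; congr _%:R; rewrite !mul1n.
  have [bu|ub] := leqP b u; last by rewrite muln0 muln0 ffact_small ?muln0.
  rewrite muln1 auv addKn -(ffact_fact bu).
  have vE : (v = a + (u - b))%N by lia.
  have := bin_fact (leq_addl a (u - b)); rewrite -vE vE addnK.
  by nia.
move=> k _; case: ifP => [|]; rewrite ltnS => kb; last first.
  by rewrite [X in (_ * (_ * X))%N]bin_small ?muln0 ?mulr0 ?mul0r // ltnNge kb.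
have [ka|ak] := leqP k a; last first.
  rewrite (@bin_small a) // mul0n muln0 mulr0 mul0r.
  (* Here [a < k <= b]: the equation [a + u = b + v] keeps [a + u - k] from being truncated, so it
     is below [u] and the binomial vanishes. *)
  have [auv|_] := eqVneq (a + u)%N (b + v)%N; last by rewrite mul0r.
  by rewrite (@bin_small (a + u - k)) ?mulr0 //; lia.
have -> : (a - k + u == b - k + v)%N = (a + u == b + v)%N by lia.
rewrite -addnBAC // !natrM !mulrA.
rewrite [LHS](_ : _ = (a + u == b + v)%:R * (-1) ^+ k * 'C(b, k)%:R *
   ((k`! * 'C(a, k) * (a - k + u)`!)%N)%:R); last by rewrite !natrM; ring.
have -> : (k`! * 'C(a, k) * (a - k + u)`! = a`! * u`! * 'C(a - k + u, u))%N.
  rewrite -(bin_fact ka) -(bin_fact (leq_addl (a - k) u)) addnK; lia.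
by rewrite !natrM; ring.
Qed.

(** Finite functions index the multi-indices of a box; a product over coordinates of sums expands
    over exactly these. *)
Definition mnm_of (n K : nat) (f : {ffun 'I_n -> 'I_K}) : multinom n :=
  Multinom (mktuple (fun j => f j : nat)).

Definition mbin (n : nat) (a k : multinom n) : nat :=
  (\prod_(j < n) 'C(a j, k j))%N.

Definition mffact (n : nat) (u b : multinom n) : nat :=
  (\prod_(j < n) u j ^_ b j)%N.

Lemma mnm_ofE (n K : nat) (f : {ffun 'I_n -> 'I_K}) j : mnm_of f j = f j.
Proof. exact: mnmE. Qed.

Lemma prod_eqmnm (n : nat) (a b : multinom n) :
  (\prod_(j < n) (a j == b j) = (a == b))%N.
Proof.
have [->|ab] := eqVneq a b; first by rewrite big1 // => j _; rewrite eqxx.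
have [j jab] : exists j, a j != b j.
  apply/existsP; rewrite -negb_forall; apply: contra ab => /forallP h.
  by apply/eqP/mnmP => j; apply/eqP.
by rewrite (bigD1 j) //= (negbTE jab).
Qed.

Lemma wick_multi (A : comNzRingType) (n K : nat) (a b u v : multinom n) :
  (forall j, a j < K)%N -> (forall j, b j < K)%N ->
  \sum_(f : {ffun 'I_n -> 'I_K}) (-1) ^+ mdeg (mnm_of f) *
    (mfact (mnm_of f) * (mbin a (mnm_of f) * mbin b (mnm_of f)))%N%:R *
    ((mnm_add (mnm_sub a (mnm_of f)) u == mnm_add (mnm_sub b (mnm_of f)) v) *
       mfact (mnm_add (mnm_sub a (mnm_of f)) u))%N%:R =
  ((mnm_add a u == mnm_add b v) * (mfact v * mffact u b))%N%:R :> A.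
Proof.
move=> aK bK.
transitivity (\prod_(j < n) ((a j + u j == b j + v j)%N *
    ((v j)`! * u j ^_ b j))%N%:R : A); last first.
  rewrite -natr_prod !big_split /=; congr (_ * _)%N%:R.
  by rewrite -prod_eqmnm; apply: eq_bigr => j _; rewrite !mnmDE.
rewrite (eq_bigr (fun j => \sum_(k < K) (-1) ^+ k *
    (k`! * ('C(a j, k) * 'C(b j, k)))%N%:R *
    ((a j - k + u j == b j - k + v j)%N * (a j - k + u j)`!)%N%:R)); last first.
  by move=> j _; rewrite wick_coord.
rewrite bigA_distr_bigA; apply: eq_bigr => f _.
rewrite !big_split /=; congr (_ * _ * _).
- by rewrite mdegE -prodrXr; apply: eq_bigr => j _; rewrite mnm_ofE.
- rewrite -!natr_prod !big_split /= /mfact /mbin.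
  congr (_ * (_ * _))%N%:R; apply: eq_bigr => j _; by rewrite mnm_ofE.
- rewrite -natr_prod big_split /= -prod_eqmnm; congr (_ * _)%N%:R;
    by apply: eq_bigr => j _; rewrite !mnmDE !mnmBE mnm_ofE.
Qed.

Lemma mffact_small (n : nat) (u b : multinom n) :
  ~~ (lem b u) -> mffact u b = 0%N.
Proof.
rewrite negb_forall => /existsP[j]; rewrite -ltnNge => uj.
by rewrite /mffact (bigD1 j) //= ffact_small.
Qed.

Lemma mffactE (n : nat) (u b : multinom n) :
  lem b u -> (mffact u b * mfact (mnm_sub u b))%N = mfact u.
Proof.
move=> /mnm_lepP bu; rewrite /mffact /mfact -big_split; apply: eq_bigr => j _.
by rewrite mnmBE /= ffact_fact.
Qed.

(** Only [w = u - b] can contribute. It occurs N!/(u-b)! times, and u!/(u-b)! is [mffact u b]. *)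
Lemma sum_words_pair (n N : nat) (a b u v : multinom n) :
  mdeg u = (mdeg b + N)%N ->
  (\sum_(w <- words n N) (u == mnm_add b w) * (v == mnm_add a w) *
     (mfact u * mfact v) =
   N`! * ((mnm_add a u == mnm_add b v) * (mfact v * mffact u b)))%N.
Proof.
move=> du; rewrite -big_distrl /=.
have [bu|bu] := boolP (lem b u); last first.
  rewrite mffact_small // !muln0 big1 // => w _.
  case: eqP => // uE; case/negP: bu; rewrite uE.
  by apply/mnm_lepP => j; rewrite mnmDE leq_addr.
have uE : u = mnm_add b (mnm_sub u b) by rewrite addmC submK.
have dw : mdeg (mnm_sub u b) = N.
  by move/eqP: du; rewrite {1}uE mdegD eqn_add2l => /eqP.
transitivity (count_mem (mnm_sub u b) (words n N) *
    (mnm_add a u == mnm_add b v) * (mfact u * mfact v))%N; last first.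
  by rewrite -(mffactE bu) -(count_words dw); lia.
congr (_ * _)%N; rewrite -sum1_count big_distrl /= [in RHS]big_mkcond.
apply: eq_bigr => w _; rewrite {1}uE eqm_add2l eq_sym.
case: eqP => [->|_]; rewrite /= ?mul1n ?mul0n //.
have -> : mnm_add a u = mnm_add b (mnm_add a (mnm_sub u b)).
  by rewrite addmA (addmC b a) -addmA -uE.
by rewrite eqm_add2l eq_sym.
Qed.

(* The left-hand side is [N!] times the Fock inner product of [d^b g] and [d^a g]
   (normal ordering); commuting the derivatives past the multiplications gives the right-hand side. *)
Lemma wick_form (R : realType) (n m N : nat) (B : seq (multinom n))
    (g V : multinom n -> R[i]) (a b : multinom n) :
  uniq B -> (forall u, (u \in B) = (mdeg u == m + N)%N) ->
  (forall u, V u = (mfact u)%:R * g u) ->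
  mdeg a = m -> mdeg b = m ->
  \sum_(w <- words n N) V (mnm_add b w) * (V (mnm_add a w))^*%C =
  N`!%:R * \sum_(f : {ffun 'I_n -> 'I_m.+1}) (-1) ^+ mdeg (mnm_of f) *
    (mfact (mnm_of f) * (mbin a (mnm_of f) * mbin b (mnm_of f)))%N%:R *
    fock B g (mnm_sub a (mnm_of f)) (mnm_sub b (mnm_of f)).
Proof.
move=> uB BE VE am bm.
have pickB (x : multinom n) (F : multinom n -> R[i]) : mdeg x = (m + N)%N ->
    F x = \sum_(u <- B) (u == x)%:R * F u.
  move=> dx; rewrite (bigD1_seq x) ?BE ?dx //= eqxx mul1r big1 ?addr0 //.
  by move=> u /negbTE ->; rewrite mul0r.
have jle (x : multinom n) j : mdeg x = m -> (x j < m.+1)%N.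
  by move=> <-; rewrite ltnS mdegE (bigD1 j) //= leq_addr.
transitivity (\sum_(u <- B) \sum_(v <- B) g u * (g v)^*%C *
   (\sum_(w <- words n N) (u == mnm_add b w) * (v == mnm_add a w) *
     (mfact u * mfact v))%N%:R).
  rewrite (eq_big_seq (fun w => \sum_(u <- B) \sum_(v <- B) g u * (g v)^*%C *
     ((u == mnm_add b w) * (v == mnm_add a w) * (mfact u * mfact v))%N%:R)).
    rewrite exchange_big /=; apply: eq_bigr => u _.
    rewrite exchange_big /=; apply: eq_bigr => v _.
    by rewrite natr_sum mulr_sumr.
  move=> w /mdeg_words dw.
  rewrite (pickB (mnm_add b w) V) ?mdegD ?bm ?dw //.
  rewrite (pickB (mnm_add a w) (fun v => (V v)^*%C)) ?mdegD ?am ?dw //.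
  rewrite mulr_suml; apply: eq_bigr => u _; rewrite mulr_sumr.
  apply: eq_bigr => v _; rewrite !VE rmorphM rmorph_nat !natrM /=; ring.
transitivity (N`!%:R * \sum_(u <- B) \sum_(v <- B) g u * (g v)^*%C *
  \sum_(f : {ffun 'I_n -> 'I_m.+1}) ((-1) ^+ mdeg (mnm_of f) *
    (mfact (mnm_of f) * (mbin a (mnm_of f) * mbin b (mnm_of f)))%N%:R *
    ((mnm_add (mnm_sub a (mnm_of f)) u == mnm_add (mnm_sub b (mnm_of f)) v) *
       mfact (mnm_add (mnm_sub a (mnm_of f)) u))%N%:R)).
  rewrite mulr_sumr; apply: eq_big_seq => u; rewrite BE => /eqP du.
  rewrite mulr_sumr; apply: eq_big_seq => v _.
  rewrite sum_words_pair ?bm // wick_multi; try by move=> j; exact: jle.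
  by rewrite natrM mulrCA.
congr (_ * _).
under eq_bigr do under eq_bigr do rewrite mulr_sumr.
under eq_bigr do rewrite exchange_big /=.
rewrite exchange_big /=; apply: eq_bigr => f _.
rewrite /fock mulr_sumr; apply: eq_bigr => u _.
rewrite mulr_sumr; apply: eq_bigr => v _; rewrite natrM; ring.
Qed.

(** * Cauchy-Schwarz bounds for the contractions *)

(** Weighted Cauchy-Schwarz: the quadratic [P - 2 t S + t^2 Q] is a weighted sum of squares, and it
    is evaluated at its minimiser [t = S / Q]. *)
Lemma sum_sqr_weighted (R : realFieldType) (I : eqType) (r : seq I) (w p q : I -> R) :
  (forall i, 0 < w i) ->
  (\sum_(i <- r) p i * q i) ^+ 2 <=
  (\sum_(i <- r) w i * p i ^+ 2) * (\sum_(i <- r) q i ^+ 2 / w i).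
Proof.
move=> w0; set S := \sum_(i <- r) p i * q i.
set P := \sum_(i <- r) w i * p i ^+ 2; set Q := \sum_(i <- r) q i ^+ 2 / w i.
have Q0 : 0 <= Q by apply: sumr_ge0 => i _; rewrite divr_ge0 ?sqr_ge0 // ltW.
have key t : 0 <= P - 2 * t * S + t ^+ 2 * Q.
  have -> : P - 2 * t * S + t ^+ 2 * Q =
      \sum_(i <- r) w i * (p i - t * q i / w i) ^+ 2.
    rewrite /P /S /Q !mulr_sumr -sumrB -big_split; apply: eq_bigr => i _.
    have := w0 i => /= wi; field; lra.
  by apply: sumr_ge0 => i _; rewrite mulr_ge0 ?sqr_ge0 // ltW.
have [Q_eq0|Qn0] := eqVneq Q 0.
  have [->|Sn0] := eqVneq S 0; first by rewrite Q_eq0 expr0n /= mulr0.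
  (* With [Q = 0] and [S] nonzero the quadratic is affine in [t], and this [t] gives it the value
     -1. *)
  have := key ((P + 1) / (2 * S)); rewrite Q_eq0 mulr0 addr0.
  have -> : P - 2 * ((P + 1) / (2 * S)) * S = - 1 by field.
  by rewrite oppr_ge0 ler10.
have := key (S / Q); rewrite [X in 0 <= X](_ : _ = (P * Q - S ^+ 2) / Q); last by field.
have Qp : 0 < Q by rewrite lt_neqAle eq_sym Qn0.
by rewrite pmulr_lge0 ?invr_gt0 // subr_ge0.
Qed.

Lemma bin_leq_exp a k : ('C(a, k) <= a ^ k)%N.
Proof.
apply: leq_trans (_ : a ^_ k <= _)%N.
  by rewrite -bin_ffact leq_pmulr // fact_gt0.
elim: k => [|k IH]; first by rewrite ffactn0.
by rewrite ffactnSr expnSr leq_mul // leq_subr.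
Qed.

Lemma fact_leq_exp m k : (k <= m)%N -> (m`! <= m ^ k * (m - k)`!)%N.
Proof.
move=> km; rewrite -(ffact_fact km) leq_mul2r; apply/orP; right.
elim: k {km} => [|k IH]; first by rewrite ffactn0.
by rewrite ffactnSr expnSr leq_mul // leq_subr.
Qed.

Lemma coord_le_mdeg (n : nat) (a : multinom n) j : (a j <= mdeg a)%N.
Proof. by rewrite mdegE (bigD1 j) //= leq_addr. Qed.

Lemma mbin_leq (n : nat) (a k : multinom n) : (mbin a k <= mdeg a ^ mdeg k)%N.
Proof.
rewrite /mbin (mdegE k) expn_sum; apply: leq_prod => j _.
apply: leq_trans (bin_leq_exp _ _) _.
by case: (k j) => [|e]; rewrite ?expn0 // leq_exp2r // coord_le_mdeg.
Qed.

Lemma mbin_small (n : nat) (a k : multinom n) : ~~ lem k a -> mbin a k = 0%N.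
Proof.
rewrite negb_forall => /existsP[j]; rewrite -ltnNge => aj.
by rewrite /mbin (bigD1 j) //= bin_small.
Qed.

Lemma mbin_fact (n : nat) (a k : multinom n) : lem k a ->
  (mbin a k * (mfact k * mfact (mnm_sub a k)))%N = mfact a.
Proof.
move=> /mnm_lepP ka; rewrite /mbin /mfact -!big_split; apply: eq_bigr => j _.
by rewrite mnmBE /= bin_fact.
Qed.

Definition sqnorm (R : realType) (n : nat) (z : 'I_n -> R[i]) : R :=
  \sum_(j < n) Normc.normc (z j) ^+ 2.

Lemma sum_bmultinom1 (A : nzSemiRingType) (n d : nat) (x : multinom n) :
  mdeg x = d -> \sum_(a : bmultinom n d.+1 | mdeg a == d) (x == a)%:R = 1 :> A.
Proof.
move=> dx; have ltx : (mdeg x < d.+1)%N by rewrite dx.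
rewrite (bigD1 (BMultinom ltx)) /= ?dx // eqxx big1 ?addr0 // => a /andP[_ ax].
by case: eqP => // xa; case/eqP: ax; apply: val_inj.
Qed.

(** The weight of y^(a-k) equals C(a,k) m!/(a-k)!. As C(a,k) <= m^|k| and m! <= m^|k| (m-|k|)!, it
    is at most m^(2|k|) times a multinomial coefficient, and the multinomial theorem sums these
    up. *)
Lemma sum_mbin_le (R : realType) (n m : nat) (k : multinom n) (y : 'I_n -> R) :
  (forall j, 0 <= y j) -> (mdeg k <= m)%N ->
  \sum_(a : bmultinom n m.+1 | mdeg a == m)
     (mfact k)%:R * ((mbin a k)%:R ^+ 2 * mmap1 y (mnm_sub a k)) /
     ((mfact a)%:R / m`!%:R) <=
  (m ^ (2 * mdeg k))%N%:R * (\sum_(j < n) y j) ^+ (m - mdeg k).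
Proof.
move=> y0 km.
have Y0 w : 0 <= mmap1 y w by apply: prodr_ge0 => j _; exact: exprn_ge0.
have posf (a : multinom n) : (mfact a)%:R != 0 :> R by rewrite pnatr_eq0 -lt0n mfact_gt0.
have posm p : p`!%:R != 0 :> R by rewrite pnatr_eq0 -lt0n fact_gt0.
rewrite -sum_mmap1_words mulr_sumr.
apply: le_trans (_ : \sum_(a : bmultinom n m.+1 | mdeg a == m)
  \sum_(w <- words n (m - mdeg k))
    (m ^ (2 * mdeg k))%N%:R * mmap1 y w * (mnm_add w k == a)%:R <= _); last first.
  rewrite exchange_big /= le_eqVlt; apply/orP; left; apply/eqP.
  apply: eq_big_seq => w /mdeg_words dw.
  by rewrite -mulr_sumr sum_bmultinom1 ?mulr1 // mdegD dw subnK.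
apply: ler_sum => a /eqP am.
have [ka|ka] := boolP (lem k a); last first.
  rewrite mbin_small // expr0n /= mul0r mulr0 mul0r.
  by apply: sumr_ge0 => w _; rewrite !mulr_ge0.
have aE : bmnm a = mnm_add (mnm_sub a k) k by rewrite submK.
have dak : mdeg (mnm_sub a k) = (m - mdeg k)%N.
  by apply/eqP; rewrite -(eqn_add2r (mdeg k)) -mdegD submK // subnK // am.
rewrite (eq_bigr (fun w => (m ^ (2 * mdeg k))%N%:R * mmap1 y (mnm_sub a k) *
   (w == mnm_sub a k)%:R)); last first.
  move=> w _; rewrite {1}aE eqm_add2r; case: eqP => [->//|_]; by rewrite !mulr0.
rewrite -mulr_sumr -natr_sum.
have -> : (\sum_(w <- words n (m - mdeg k)) (w == mnm_sub a k) =
    count_mem (mnm_sub a k) (words n (m - mdeg k)))%N.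
  by rewrite -sum1_count [in RHS]big_mkcond; apply: eq_bigr => w _ /=; case: (w == _).
rewrite [X in _ <= X]mulrAC [X in X <= _](_ : _ = (mfact k * (mbin a k ^ 2) * m`!)%N%:R /
   (mfact a)%:R * mmap1 y (mnm_sub a k)); last first.
  rewrite !natrM; field; by rewrite posf posm.
apply: ler_wpM2r => //.
rewrite ler_pdivrMr ?ltr0n ?mfact_gt0 // -!natrM ler_nat.
rewrite -(mbin_fact ka).
have h1 := mbin_leq a k; rewrite am in h1.
have h2 := fact_leq_exp km; rewrite -(count_words dak) in h2.
set ct := count_mem _ _ in h2 *.
have -> : (mfact k * mbin a k ^ 2 * m`! =
  (mbin a k * mfact k) * (mbin a k * m`!))%N by lia.
have -> : (m ^ (2 * mdeg k) * ct * (mbin a k * (mfact k * mfact (mnm_sub a k))) =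
   (mbin a k * mfact k) *
     (m ^ mdeg k * (m ^ mdeg k * (ct * mfact (mnm_sub a k)))))%N.
  by rewrite mul2n -addnn expnD; lia.
by rewrite leq_mul2l; apply/orP; right; rewrite leq_mul.
Qed.

Lemma normc_sum (R : realType) (I : Type) (r : seq I) (P : pred I) (F : I -> R[i]) :
  Normc.normc (\sum_(i <- r | P i) F i) <= \sum_(i <- r | P i) Normc.normc (F i).
Proof.
elim/big_rec2: _ => [|i y x _ IH]; first by rewrite Normc.normc0.
by apply: le_trans (le_normcD _ _) _; rewrite lerD2l.
Qed.

Lemma normc_ge0 (R : rcfType) (x : R[i]) : 0 <= Normc.normc x.
Proof. by case: x => a b /=; rewrite sqrtr_ge0. Qed.

Lemma Re_le_normc (R : rcfType) (x : R[i]) : `|complex.Re x| <= Normc.normc x.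
Proof. by have := normc_ge_Re x; rewrite -[`|x|]/((Normc.normc x)%:C%C) lecR. Qed.

Lemma normc_mmap1 (R : realType) (n : nat) (z : 'I_n -> R[i]) (a : multinom n) :
  Normc.normc (mmap1 z a) = mmap1 (fun j => Normc.normc (z j)) a.
Proof.
rewrite /mmap1; elim/big_rec2: _ => [|j y x _ IH]; first by rewrite Normc.normc1.
rewrite Normc.normcM IH; congr (_ * _).
elim: (a j) => [|p IHp]; first by rewrite !expr0 Normc.normc1.
by rewrite !exprS Normc.normcM IHp.
Qed.

Lemma normc_nat (R : realType) p : Normc.normc (p%:R : R[i]) = p%:R.
Proof.
rewrite -[p%:R]/(1 *+ p) -[LHS]/(Normc.normc ((1 : Rcomplex R) *+ p)).
by rewrite normcMn Normc.normc1.
Qed.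

(** Cauchy-Schwarz over pairs [(a, b)] with weights a! b!/m!^2 turns the coefficients into
    [biform_norm]. The other factor splits as a square [Q ^+ 2], and [sum_mbin_le] at y_j = |z_j|^2
    bounds [Q]. *)
Lemma contraction_bound (R : realType) (n m : nat)
    (c : multinom n -> multinom n -> R[i]) (k : multinom n) (z : 'I_n -> R[i]) :
  (mdeg k <= m)%N ->
  `|complex.Re (\sum_(a : bmultinom n m.+1 | mdeg a == m)
    \sum_(b : bmultinom n m.+1 | mdeg b == m)
     c a b * (mfact k * (mbin a k * mbin b k))%N%:R *
     (mmap1 z (mnm_sub a k) * mmap1 (fun j => (z j)^*%C) (mnm_sub b k)))| <=
  biform_norm m c * (m ^ (2 * mdeg k))%N%:R * sqnorm z ^+ (m - mdeg k).
Proof.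
move=> km; apply: le_trans (Re_le_normc _) _.
pose X (a : multinom n) : R := (mbin a k)%:R * Normc.normc (mmap1 z (mnm_sub a k)).
pose hom := [seq a : bmultinom n m.+1 <- index_enum (bmultinom n m.+1) | mdeg a == m].
pose r := [seq (a, b) | a <- hom, b <- hom].
have rE (F : bmultinom n m.+1 -> bmultinom n m.+1 -> R) :
    \sum_(a : bmultinom n m.+1 | mdeg a == m)
      \sum_(b : bmultinom n m.+1 | mdeg b == m) F a b = \sum_(t <- r) F t.1 t.2.
  by rewrite big_allpairs_dep big_filter; apply: eq_bigr => a _; rewrite big_filter.
pose w (a : multinom n) : R := (mfact a)%:R / m`!%:R.
have w0 a : 0 < w a by rewrite divr_gt0 ?ltr0n ?mfact_gt0 ?fact_gt0.
apply: le_trans (_ : \sum_(t <- r) Normc.normc (c t.1 t.2) *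
   ((mfact k)%:R * (X t.1 * X t.2)) <= _).
  rewrite -(rE (fun a b => Normc.normc (c a b) * ((mfact k)%:R * (X a * X b)))).
  apply: le_trans (normc_sum _ _ _) _; apply: ler_sum => a _.
  apply: le_trans (normc_sum _ _ _) _; apply: ler_sum => b _.
  rewrite !Normc.normcM normc_nat mmap1_conj /X !natrM.
  have -> : Normc.normc (mmap1 z (mnm_sub b k))^*%C = Normc.normc (mmap1 z (mnm_sub b k)).
    by case: (mmap1 z _) => x y /=; rewrite sqrrN.
  by rewrite le_eqVlt; apply/orP; left; apply/eqP; ring.
have CS := @sum_sqr_weighted R _ r (fun t => w t.1 * w t.2)
  (fun t => Normc.normc (c t.1 t.2)) (fun t => (mfact k)%:R * (X t.1 * X t.2))
  (fun t => mulr_gt0 (w0 t.1) (w0 t.2)).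
set S := \sum_(t <- r) _ in CS *.
pose Q := \sum_(a : bmultinom n m.+1 | mdeg a == m) (mfact k)%:R * X a ^+ 2 / w a.
have Q0 : 0 <= Q.
  apply: sumr_ge0 => a _; apply: divr_ge0; last exact: ltW.
  by apply: mulr_ge0 => //; exact: sqr_ge0.
have QE : \sum_(t <- r) ((mfact k)%:R * (X t.1 * X t.2)) ^+ 2 / (w t.1 * w t.2) = Q ^+ 2.
  rewrite -(rE (fun a b => ((mfact k)%:R * (X a * X b)) ^+ 2 / (w a * w b))).
  rewrite expr2 /Q mulr_suml; apply: eq_bigr => a _.
  rewrite mulr_sumr; apply: eq_bigr => b _.
  have := w0 a; have := w0 b => wb wa; field; lra.
have LE : \sum_(t <- r) w t.1 * w t.2 * Normc.normc (c t.1 t.2) ^+ 2 = biform_norm m c ^+ 2.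
  rewrite -(rE (fun a b => w a * w b * Normc.normc (c a b) ^+ 2)) /biform_norm sqr_sqrtr.
    apply: eq_bigr => a _; apply: eq_bigr => b _; congr (_ * _).
    by rewrite /w; field; rewrite pnatr_eq0 -lt0n fact_gt0.
  apply: sumr_ge0 => a _; apply: sumr_ge0 => b _; apply: mulr_ge0; last exact: sqr_ge0.
  by apply: divr_ge0; [exact: mulr_ge0|exact: exprn_ge0].
rewrite QE LE -exprMn in CS.
have L0 : 0 <= biform_norm m c by rewrite sqrtr_ge0.
apply: le_trans (_ : biform_norm m c * Q <= _).
  have S0 : 0 <= S.
    apply: sumr_ge0 => t _; apply: mulr_ge0; first exact: normc_ge0.
    by apply: mulr_ge0 => //; rewrite /X !mulr_ge0 ?normc_ge0.
  by rewrite -ler_sqr ?nnegrE //; exact: mulr_ge0.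
rewrite -mulrA ler_wpM2l //.
have := @sum_mbin_le R n m k (fun j => Normc.normc (z j) ^+ 2) (fun j => sqr_ge0 _) km.
apply: le_trans; rewrite le_eqVlt; apply/orP; left; apply/eqP.
apply: eq_bigr => a _; rewrite /X exprMn normc_mmap1; congr (_ * (_ * _) / _).
by rewrite /mmap1 -prodrXl; apply: eq_bigr => j _; rewrite exprAC.
Qed.

(** * Fock norms: comparison and growth *)

(** The Gaussian integral of |z|^(2p) |g|^2, as |z|^(2p) is the sum of |z^w|^2 over the words
    [w]. *)
Definition fock_sqnorm (R : realType) (n : nat) (B : seq (multinom n))
    (g : multinom n -> R[i]) (p : nat) : R :=
  complex.Re (\sum_(w <- words n p) fock B g w w).

Lemma sqnormE (R : realType) (n p : nat) (z : 'I_n -> R[i]) :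
  \sum_(w <- words n p) mmap1 z w * mmap1 (fun j => (z j)^*%C) w =
  (sqnorm z ^+ p)%:C%C.
Proof.
rewrite (eq_bigr (fun w => mmap1 (fun j => z j * (z j)^*%C) w)); last first.
  by move=> w _; rewrite /mmap1 -big_split; apply: eq_bigr => j _; rewrite exprMn.
rewrite sum_mmap1_words rmorphXn /sqnorm rmorph_sum; congr (_ ^+ _).
apply: eq_bigr => j _; case: (z j) => x y /=.
by rewrite sqr_sqrtr ?addr_ge0 ?sqr_ge0 //; simpc; congr (_ +i* _)%C; ring.
Qed.

(** Monotonicity of the integral: [fock_ge0] applied to the form minus D |z|^(2p), whose terms are
    listed in [r]. *)
Lemma fock_lower (R : realType) (n p : nat) (B : seq (multinom n))
    (g : multinom n -> R[i]) (D : R) (I : finType) (P : pred I)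
    (c : I -> I -> R[i]) (al be : I -> multinom n) :
  (forall z : 'I_n -> R[i], D * sqnorm z ^+ p <= complex.Re
     (\sum_(i | P i) \sum_(j | P j)
        c i j * (mmap1 z (al i) * mmap1 (fun j => (z j)^*%C) (be j)))) ->
  D * fock_sqnorm B g p <= complex.Re
     (\sum_(i | P i) \sum_(j | P j) c i j * fock B g (al i) (be j)).
Proof.
move=> Hz; pose s := [seq i <- index_enum I | P i].
pose r := [seq (c i j, al i, be j) | i <- s, j <- s] ++
  [seq (- D%:C%C, w, w) | w <- words n p].
have rE (F : R[i] * multinom n * multinom n -> R[i]) : \sum_(t <- r) F t =
    \sum_(i | P i) \sum_(j | P j) F (c i j, al i, be j) +
    \sum_(w <- words n p) F (- D%:C%C, w, w).
  rewrite big_cat big_map big_allpairs_dep big_filter; congr (_ + _).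
  by apply: eq_bigr => i _; rewrite big_filter.
have := @fock_ge0 R n B g _ r (fun t => t.1.1) (fun t => t.1.2) (fun t => t.2).
rewrite rE /= -mulr_sumr.
set T := \sum_(i | P i) _.
have ReND (x : R[i]) (y : R) : complex.Re (x + - D%:C%C * y%:C%C) = complex.Re x - D * y.
  by case: x => x1 x2 /=; rewrite oppr0 mulr0 subr0 mulNr.
have -> : \sum_(w <- words n p) fock B g w w =
    (fock_sqnorm B g p)%:C%C + 'i%C * (complex.Im (\sum_(w <- words n p) fock B g w w))%:C%C.
  exact: complexE.
move=> H; have : 0 <= complex.Re T - D * fock_sqnorm B g p.
  have /H : forall z : 'I_n -> R[i], 0 <= complex.Re (\sum_(t <- r) t.1.1 *
      (mmap1 z t.1.2 * mmap1 (fun j => (z j)^*%C) t.2)).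
    by move=> z; rewrite rE /= -mulr_sumr sqnormE ReND subr_ge0 Hz.
  congr (0 <= _); case: (T) => x y /=; ring.
by rewrite subr_ge0.
Qed.

(** Orthogonality of monomials leaves the terms [u = v], and the common degree [M] makes the rising
    factorial a common factor. *)
Lemma fock_sqnormE (R : realType) (n p M : nat) (B : seq (multinom n))
    (g : multinom n -> R[i]) :
  uniq B -> (forall u, u \in B -> mdeg u = M) ->
  fock_sqnorm B g p = (\sum_(u <- B) Normc.normc (g u) ^+ 2 * (mfact u)%:R) *
    (\prod_(i < p) (M + n + i))%N%:R.
Proof.
move=> uB BM.
have fE w : fock B g w w =
    (\sum_(u <- B) Normc.normc (g u) ^+ 2 * (mfact (mnm_add w u))%:R)%:C%C.
  rewrite /fock rmorph_sum; apply: eq_big_seq => u uinB.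
  rewrite (bigD1_seq u) //= eqxx mul1r big1 ?addr0.
    rewrite rmorphM rmorph_nat; congr (_ * _).
    case: (g u) => x y /=; rewrite sqr_sqrtr ?addr_ge0 ?sqr_ge0 //.
    by simpc; congr (_ +i* _)%C; ring.
  by move=> v vu; rewrite eqm_add2l eq_sym (negbTE vu) mul0r mulr0.
rewrite /fock_sqnorm (eq_bigr _ (fun w _ => fE w)) -rmorph_sum /=.
rewrite exchange_big mulr_suml; apply: eq_big_seq => u uinB.
by rewrite -mulr_sumr -natr_sum sum_mfact_words natrM (BM _ uinB) mulrA.
Qed.

Lemma fock_sqnorm_ge0 (R : realType) (n p M : nat) (B : seq (multinom n))
    (g : multinom n -> R[i]) :
  uniq B -> (forall u, u \in B -> mdeg u = M) -> 0 <= fock_sqnorm B g p.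
Proof.
move=> uB BM; rewrite (fock_sqnormE p g uB BM) mulr_ge0 //.
by apply: sumr_ge0 => u _; rewrite mulr_ge0 ?sqr_ge0.
Qed.

(** Passing from [p - 1] to [p] multiplies the integral by [M + n + p - 1], which is at least
    [N]. *)
Lemma fock_sqnorm_growth (R : realType) (n p k M N : nat) (B : seq (multinom n))
    (g : multinom n -> R[i]) :
  uniq B -> (forall u, u \in B -> mdeg u = M) -> (N <= M)%N -> (k <= p)%N ->
  N%:R ^+ k * fock_sqnorm B g (p - k) <= fock_sqnorm B g p.
Proof.
move=> uB BM NM kp; rewrite !(fock_sqnormE _ g uB BM) mulrCA.
apply: ler_wpM2l; first by apply: sumr_ge0 => u _; rewrite mulr_ge0 ?sqr_ge0.
rewrite -natrX -natrM ler_nat.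
elim: k kp => [|k IH] kp; first by rewrite expn0 mul1n subn0.
apply: leq_trans (IH (ltnW kp)); rewrite expnSr -mulnA leq_mul2l.
have -> : (p - k = (p - k.+1).+1)%N by lia.
by rewrite big_ord_recr /= mulnC leq_mul2l; apply/orP; right; apply/orP; right; lia.
Qed.

(** * Positivity of the Gram form *)

(** With [x = n y], the sum is the [n]-th power of a geometric sum, at most (1 - y)^(-n), hence at
    most 1/(1 - x) by Bernoulli, hence at most 1 + 2x as x <= 1/2. *)
Lemma sum_geom_box (R : realFieldType) (n m : nat) (y : R) :
  0 <= y -> n%:R * y <= 1 / 2 ->
  \sum_(f : {ffun 'I_n -> 'I_m.+1}) y ^+ mdeg (mnm_of f) <= 1 + 2 * (n%:R * y).
Proof.
move=> y0 ny.
have -> : \sum_(f : {ffun 'I_n -> 'I_m.+1}) y ^+ mdeg (mnm_of f) =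
    (\sum_(k < m.+1) y ^+ k) ^+ n.
  rewrite -[in RHS](card_ord n) -prodr_const bigA_distr_bigA.
  by apply: eq_bigr => f _; rewrite mdegE -prodrXr; apply: eq_bigr => j _; rewrite mnm_ofE.
case: n ny => [|n] ny; first by rewrite expr0 mul0r mulr0 addr0.
have y1 : y <= 1 / 2.
  by apply: le_trans ny; rewrite -[X in X <= _]mul1r ler_wpM2r // ler1n.
set G := \sum_(k < m.+1) y ^+ k.
have G0 : 0 <= G by apply: sumr_ge0 => k _; exact: exprn_ge0.
have GE : (1 - y) * G = 1 - y ^+ m.+1.
  by rewrite -[1 - y ^+ m.+1]opprB subrX1 -mulNr opprB.
have h1 : ((1 - y) * G) ^+ n.+1 <= 1.
  have ym : 0 <= y ^+ m.+1 by exact: exprn_ge0.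
  apply: exprn_ile1; rewrite GE; last by lra.
  by rewrite subr_ge0 exprn_ile1 //; lra.
have bern k : 1 - k%:R * y <= (1 - y) ^+ k.
  elim: k => [|k IH]; first by rewrite expr0 mul0r subr0.
  rewrite exprS; apply: le_trans (_ : (1 - y) * (1 - k%:R * y) <= _); last first.
    by rewrite ler_wpM2l //; lra.
  have : 0 <= k%:R * y * y by rewrite !mulr_ge0.
  by rewrite -natr1; lra.
have Gn0 : 0 <= G ^+ n.+1 by exact: exprn_ge0.
have h2 : (1 - n.+1%:R * y) * G ^+ n.+1 <= 1.
  by apply: le_trans h1; rewrite exprMn ler_wpM2r.
have x0 : 0 <= n.+1%:R * y by rewrite mulr_ge0.
move: h2 x0 ny; set x := n.+1%:R * y; set H := G ^+ n.+1 => h2 x0 ny.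
have h3 : (1 - x) * H <= (1 - x) * (1 + 2 * x).
  apply: le_trans h2 _; have : 0 <= x * (1 - 2 * x) by rewrite mulr_ge0 //; lra.
  lra.
by rewrite ler_pM2l in h3 => //; lra.
Qed.

(** The first bound on [N] makes [sum_geom_box] applicable to [y = m^2 / N]; the second makes the
    resulting tail no larger than the leading term. *)
Lemma gram_ge0 (R : realType) (n m N : nat) (B : seq (multinom n))
    (c : multinom n -> multinom n -> R[i]) (lam : R) (V : multinom n -> R[i]) :
  uniq B -> (forall u, (u \in B) = (mdeg u == m + N)%N) -> (0 < N)%N ->
  (forall z : 'I_n -> R[i], lam * sqnorm z ^+ m <= complex.Re
     (\sum_(a : bmultinom n m.+1 | mdeg a == m)
        \sum_(b : bmultinom n m.+1 | mdeg b == m)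
        c a b * (mmap1 z a * mmap1 (fun j => (z j)^*%C) b))) ->
  2 * (n%:R * m%:R ^+ 2) <= N%:R :> R ->
  2 * (n%:R * m%:R ^+ 2) * biform_norm m c <= N%:R * lam ->
  0 <= complex.Re (\sum_(w <- words n N)
    \sum_(a : bmultinom n m.+1 | mdeg a == m)
      \sum_(b : bmultinom n m.+1 | mdeg b == m)
        c a b * (V (mnm_add b w) * (V (mnm_add a w))^*%C)).
Proof.
move=> uB BE N0 Hlam HN HL.
pose g u : R[i] := V u / (mfact u)%:R.
have VE u : V u = (mfact u)%:R * g u.
  by rewrite /g mulrC divfK // pnatr_eq0 -lt0n mfact_gt0.
have BM u : u \in B -> mdeg u = (m + N)%N by rewrite BE => /eqP.
pose K := {ffun 'I_n -> 'I_m.+1}.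
pose T (f : K) : R := complex.Re (\sum_(a : bmultinom n m.+1 | mdeg a == m)
   \sum_(b : bmultinom n m.+1 | mdeg b == m)
   c a b * (mfact (mnm_of f) * (mbin a (mnm_of f) * mbin b (mnm_of f)))%N%:R *
   fock B g (mnm_sub a (mnm_of f)) (mnm_sub b (mnm_of f))).
set L := biform_norm m c in HL.
have L0 : 0 <= L by rewrite sqrtr_ge0.
pose s p := fock_sqnorm B g p.
have s0 p : 0 <= s p by exact: fock_sqnorm_ge0 uB BM.
(* The cost of each contraction: m^2 from the coefficient bound, 1/N from the growth of the
   norms. *)
pose y : R := m%:R ^+ 2 / N%:R.
have NR0 : 0 < N%:R :> R by rewrite ltr0n.
have y0 : 0 <= y by rewrite divr_ge0 // exprn_ge0.
have -> : \sum_(w <- words n N) \sum_(a : bmultinom n m.+1 | mdeg a == m)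
    \sum_(b : bmultinom n m.+1 | mdeg b == m)
      c a b * (V (mnm_add b w) * (V (mnm_add a w))^*%C) =
    N`!%:R * \sum_(f : K) (-1) ^+ mdeg (mnm_of f) *
     (\sum_(a : bmultinom n m.+1 | mdeg a == m)
      \sum_(b : bmultinom n m.+1 | mdeg b == m)
      c a b * (mfact (mnm_of f) * (mbin a (mnm_of f) * mbin b (mnm_of f)))%N%:R *
      fock B g (mnm_sub a (mnm_of f)) (mnm_sub b (mnm_of f))).
  rewrite exchange_big /=.
  under [in RHS]eq_bigr do rewrite mulr_sumr.
  rewrite [in RHS]exchange_big /= mulr_sumr; apply: eq_bigr => a /eqP am.
  rewrite exchange_big /=.
  under [in RHS]eq_bigr do rewrite mulr_sumr.
  rewrite [in RHS]exchange_big /= mulr_sumr; apply: eq_bigr => b /eqP bm.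
  rewrite -mulr_sumr (wick_form uB BE VE am bm) mulrCA; congr (_ * _).
  by rewrite mulr_sumr; apply: eq_bigr => f _; ring.
have -> : complex.Re (N`!%:R * \sum_(f : K) (-1) ^+ mdeg (mnm_of f) *
     (\sum_(a : bmultinom n m.+1 | mdeg a == m)
      \sum_(b : bmultinom n m.+1 | mdeg b == m)
      c a b * (mfact (mnm_of f) * (mbin a (mnm_of f) * mbin b (mnm_of f)))%N%:R *
      fock B g (mnm_sub a (mnm_of f)) (mnm_sub b (mnm_of f)))) =
    N`!%:R * \sum_(f : K) (-1) ^+ mdeg (mnm_of f) * T f.
  have ReM (r : R) (x : R[i]) : complex.Re (r%:C%C * x) = r * complex.Re x.
    by case: x => x1 x2 /=; rewrite mul0r subr0.
  rewrite -(rmorph_nat (real_complex R)) ReM; congr (_ * _).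
  rewrite raddf_sum /=; apply: eq_bigr => f _.
  by rewrite -[-1](rmorphN1 (real_complex R)) -rmorphXn ReM.
apply: mulr_ge0 => //.
(* The box also contains multi-indices of degree above [m]; none of them lies below an [a] of degree
   [m]. *)
have bigT f : (m < mdeg (mnm_of f))%N -> T f = 0.
  move=> mf; rewrite /T big1 // => a /eqP am; rewrite big1 // => b _.
  rewrite mbin_small ?mul0n ?muln0 ?mulr0 ?mul0r //.
  apply/negP => /mnm_lepP fa.
  have : (mdeg (mnm_of f) <= mdeg a)%N by rewrite !mdegE leq_sum.
  by rewrite am leqNgt mf.
have boundT f : `|T f| <= L * y ^+ mdeg (mnm_of f) * s m.
  have [fm|fm] := leqP (mdeg (mnm_of f)) m; last first.
    by rewrite (bigT _ fm) normr0 !mulr_ge0 // exprn_ge0.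
  set k := mdeg (mnm_of f) in fm *.
  apply: le_trans (_ : L * (m ^ (2 * k))%N%:R * s (m - k)%N <= _); last first.
    rewrite /y expr_div_n -!mulrA ler_wpM2l // natrX exprM -natrX natrX.
    rewrite ler_wpM2l ?exprn_ge0 // mulrC ler_pdivlMr ?exprn_gt0 // mulrC.
    by apply: (fock_sqnorm_growth _ uB BM) => //; rewrite leq_addl.
  have CB z := @contraction_bound R n m c (mnm_of f) z fm.
  rewrite ler_norml; apply/andP; split; last first.
    (* The upper bound is the lower bound for the negated coefficients. *)
    rewrite -lerN2 -mulNr.
    rewrite [X in _ <= X](_ : _ = complex.Re
      (\sum_(a : bmultinom n m.+1 | mdeg a == m)
       \sum_(b : bmultinom n m.+1 | mdeg b == m)
       (- (c a b * (mfact (mnm_of f) * (mbin a (mnm_of f) * mbin b (mnm_of f)))%N%:R)) *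
       fock B g (mnm_sub a (mnm_of f)) (mnm_sub b (mnm_of f)))); last first.
      rewrite /T -raddfN -sumrN; congr complex.Re; apply: eq_bigr => a _.
      by rewrite -sumrN; apply: eq_bigr => b _; rewrite mulNr.
    apply: fock_lower => z; have := CB z; rewrite ler_norml => /andP[_].
    rewrite -lerN2 mulNr => /le_trans; apply.
    rewrite -raddfN -sumrN le_eqVlt; apply/orP; left; apply/eqP; congr complex.Re.
    by apply: eq_bigr => a _; rewrite -sumrN; apply: eq_bigr => b _; rewrite mulNr.
  rewrite -mulNr; apply: fock_lower => z; have := CB z; rewrite ler_norml => /andP[+ _].
  by rewrite mulNr.
pose f0 : K := [ffun=> ord0].
have f00 : mnm_of f0 = mnm0 by apply/mnmP => j; rewrite mnm_ofE ffunE mnm0E.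
have T0 : lam * s m <= T f0.
  rewrite /T f00 mfact0.
  have b0 a : @mbin n a mnm0 = 1%N by rewrite /mbin big1 // => j _; rewrite mnm0E bin0.
  apply: fock_lower => z; apply: le_trans (Hlam z) _.
  rewrite le_eqVlt; apply/orP; left; apply/eqP; congr complex.Re.
  by apply: eq_bigr => a _; apply: eq_bigr => b _; rewrite !b0 mulr1 !subm0.
have geo : \sum_(f : K | f != f0) y ^+ mdeg (mnm_of f) <= 2 * (n%:R * y).
  have := @sum_geom_box R n m y y0; rewrite (bigD1 f0) //= f00 mdeg0 expr0 lerD2l.
  apply; rewrite /y mulrA ler_pdivrMr //; lra.
rewrite (bigD1 f0) //= f00 mdeg0 expr0 mul1r.
have tail : - (L * (2 * (n%:R * y)) * s m) <=
    \sum_(f : K | f != f0) (-1) ^+ mdeg (mnm_of f) * T f.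
  apply: le_trans (_ : - (\sum_(f : K | f != f0) L * y ^+ mdeg (mnm_of f) * s m) <= _).
    by rewrite lerN2 -mulr_suml -mulr_sumr ler_wpM2r // ler_wpM2l.
  rewrite -sumrN; apply: ler_sum => f _; rewrite lerNl.
  by apply: le_trans (boundT f); rewrite -mulNr; apply: le_trans (ler_norm _) _;
    rewrite normrM normrN normrX normrN1 expr1n mul1r.
have main : L * (2 * (n%:R * y)) <= lam.
  rewrite /y [X in X <= _](_ : _ = 2 * (n%:R * m%:R ^+ 2) * L / N%:R); last by ring.
  by rewrite ler_pdivrMr // [lam * _]mulrC.
have := ler_wpM2r (s0 m) main; lra.
Qed.

(** * From positive semidefinite matrices to sums of squares *)

(** Spectral theorem: each eigenvalue is the value of the form at a row of the unitary [P], hence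
    nonnegative, and [S] is the adjoint of [P] times the square root of the diagonal. *)
Lemma psd_decomp (C : numClosedFieldType) (d : nat) (H : 'M[C]_d) :
  (forall i j, H i j = (H j i)^* ) ->
  (forall v : 'I_d -> C, 0 <= \sum_i \sum_j v i * H i j * (v j)^* ) ->
  exists S : 'M[C]_d, forall i j, H i j = \sum_l S i l * (S j l)^*.
Proof.
move=> Hherm Hpos.
have Hh : H \is hermsymmx.
  by apply/is_hermitianmxP; rewrite expr0 scale1r; apply/matrixP => i j; rewrite !mxE.
set P := spectralmx H; set D := spectral_diag H.
have HE := orthomx_spectralP (hermitian_normalmx Hh); rewrite -/P -/D in HE.
have PU : P \is unitarymx by exact: spectral_unitarymx.
have PP : P *m (P ^t* )%sesqui = 1%:M by apply/unitarymxP.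
rewrite (invmx_unitary PU) in HE.
have DE : P *m H *m (P ^t* )%sesqui = diag_mx D.
  by rewrite HE !mulmxA PP mul1mx -mulmxA PP mulmx1.
have D0 l : 0 <= D 0 l.
  have := Hpos (fun i => P l i); congr (0 <= _).
  have <- : (P *m H *m (P ^t* )%sesqui) l l = D 0 l by rewrite DE mxE eqxx mulr1n.
  rewrite mxE exchange_big /=; apply: eq_bigr => j _.
  by rewrite !mxE mulr_suml.
exists (\matrix_(i, l) ((P l i)^* * sqrtC (D 0 l))) => i j.
rewrite HE mxE; apply: eq_bigr => l _; rewrite !mxE.
rewrite (bigD1 l) //= !mxE eqxx mulr1n big1 ?addr0; last first.
  by move=> k kl; rewrite !mxE (negbTE kl) mulr0n mulr0.
have sD : (sqrtC (D 0 l))^* = sqrtC (D 0 l).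
  by apply/CrealP/ger0_real; rewrite sqrtC_ge0.
move: (sqrtC (D 0 l)) (sqrtCK (D 0 l)) sD => s <- sD.
by rewrite rmorphM /= conjCK sD; ring.
Qed.

(** [E] is the matrix of the form on vectors indexed by [B]. Its Hermitian part [H] represents the
    real part of the form, and [psd_decomp] factors [H]. *)
Lemma gram_squares (R : realType) (n : nat) (B : seq (multinom n)) (I : eqType)
    (r : seq I) (c : I -> R[i]) (al be : I -> multinom n) :
  uniq B -> (forall t, t \in r -> (al t \in B) && (be t \in B)) ->
  (forall V : multinom n -> R[i], 0 <= complex.Re
     (\sum_(t <- r) c t * (V (be t) * (V (al t))^*%C))) ->
  exists p : 'I_(size B) -> 'I_(size B) -> R[i],
  forall V : multinom n -> R[i],
    (complex.Re (\sum_(t <- r) c t * (V (be t) * (V (al t))^*%C)))%:C%C =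
    \sum_l `|\sum_i p l i * V (nth mnm0 B i)| ^+ 2.
Proof.
move=> uB rB Hpos; set d := size B; pose mu (i : 'I_d) := nth mnm0 B i.
pose E : 'M[R[i]]_d :=
  \matrix_(i, j) \sum_(t <- r) c t * ((be t == mu i)%:R * (al t == mu j)%:R).
pose H : 'M[R[i]]_d := \matrix_(i, j) ((E i j + (E j i)^* ) / 2%:R).
have pick (x : multinom n) (F : multinom n -> R[i]) : x \in B ->
    F x = \sum_(i < d) (x == mu i)%:R * F (mu i).
  move=> xB; have xd : (index x B < d)%N by rewrite index_mem.
  rewrite (bigD1 (Ordinal xd)) //= {1 2}/mu /= nth_index // eqxx mul1r big1 ?addr0 //.
  move=> i ix; case: eqP => [xE|_]; last by rewrite mul0r.
  by case/eqP: ix; apply: val_inj; rewrite /= xE index_uniq.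
have EV V : \sum_(t <- r) c t * (V (be t) * (V (al t))^* ) =
    \sum_i \sum_j V (mu i) * E i j * (V (mu j))^*.
  transitivity (\sum_(t <- r) \sum_i \sum_j V (mu i) *
     (c t * ((be t == mu i)%:R * (al t == mu j)%:R)) * (V (mu j))^* ).
    apply: eq_big_seq => t /rB /andP[alB beB].
    rewrite (pick _ V beB) (pick _ (fun x => (V x)^* ) alB).
    rewrite mulr_suml mulr_sumr; apply: eq_bigr => i _.
    by rewrite !mulr_sumr; apply: eq_bigr => j _; ring.
  rewrite exchange_big; apply: eq_bigr => i _.
  rewrite exchange_big; apply: eq_bigr => j _.
  by rewrite mxE mulr_sumr mulr_suml.
have HV V : \sum_i \sum_j V (mu i) * H i j * (V (mu j))^* =
    (complex.Re (\sum_(t <- r) c t * (V (be t) * (V (al t))^*%C)))%:C%C.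
  rewrite ReJ_add -[_^*%C]/((\sum_(t <- r) c t * (V (be t) * (V (al t))^* ))^* ).
  rewrite -[\sum_(t <- r) c t * (V (be t) * (V (al t))^*%C)]/(\sum_(t <- r)
    c t * (V (be t) * (V (al t))^* )).
  rewrite EV rmorph_sum /=.
  have -> : \sum_i (\sum_j V (mu i) * E i j * (V (mu j))^* )^* =
      \sum_i \sum_j V (mu i) * (E j i)^* * (V (mu j))^*.
    rewrite exchange_big /=; apply: eq_bigr => i _; rewrite rmorph_sum.
    by apply: eq_bigr => j _; rewrite !rmorphM /= conjCK; ring.
  rewrite -big_split mulr_suml; apply: eq_bigr => i _.
  rewrite -big_split mulr_suml; apply: eq_bigr => j _.
  by rewrite mxE /=; ring.
have Hherm i j : H i j = (H j i)^*.
  by rewrite !mxE rmorphM rmorphD /= conjCK fmorphV rmorph_nat addrC.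
have [|S HS] := @psd_decomp _ d H Hherm.
  (* The hypothesis concerns functions on multi-indices, so [v] is extended by 0 outside [B]. *)
  move=> v; pose V (x : multinom n) : R[i] :=
    if insub (index x B) is Some i then v i else 0.
  have VE i : V (mu i) = v i.
    rewrite /V index_uniq // insubT // => h; congr v; exact: val_inj.
  have := Hpos V; rewrite -(@lecR R) -HV.
  by under eq_bigr do under eq_bigr do rewrite !VE.
exists (fun l i => S i l) => V; rewrite -HV.
transitivity (\sum_i \sum_l \sum_j (S i l * V (mu i)) * (S j l * V (mu j))^* ).
  apply: eq_bigr => i _; rewrite exchange_big; apply: eq_bigr => j _.
  rewrite HS mulr_sumr mulr_suml; apply: eq_bigr => l _.
  by rewrite rmorphM /=; ring.
rewrite exchange_big; apply: eq_bigr => l _.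
rewrite normCK rmorph_sum mulr_suml; apply: eq_bigr => i _.
by rewrite mulr_sumr.
Qed.

(** * Homogeneity and the size of the minimum *)

Lemma biformE (R : realType) (n m : nat) (c : multinom n -> multinom n -> R[i])
    (z : 'rV[R[i]]_n) :
  biform m c z = \sum_(a : bmultinom n m.+1 | mdeg a == m)
    \sum_(b : bmultinom n m.+1 | mdeg b == m)
    c a b * (mmap1 (z 0) a * mmap1 (fun j => (z 0 j)^*%C) b).
Proof. by apply: eq_bigr => a _; apply: eq_bigr => b _; rewrite mulrA. Qed.

Lemma mmap1Z (S : comNzRingType) (n : nat) (t : S) (h : 'I_n -> S) (a : multinom n) :
  mmap1 (fun j => t * h j) a = t ^+ mdeg a * mmap1 h a.
Proof.
rewrite /mmap1 mdegE -prodrXr -big_split; apply: eq_bigr => j _.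
by rewrite exprMn.
Qed.

Lemma biformZ (R : realType) (n m : nat) (c : multinom n -> multinom n -> R[i])
    (t : R) (z : 'rV[R[i]]_n) :
  biform m c (t%:C%C *: z) = (t ^+ (2 * m))%:C%C * biform m c z.
Proof.
rewrite !biformE mulr_sumr; apply: eq_bigr => a /eqP am.
rewrite mulr_sumr; apply: eq_bigr => b /eqP bm.
have -> : mmap1 ((t%:C%C *: z) 0) a = t%:C%C ^+ m * mmap1 (z 0) a.
  by rewrite -{2}am -mmap1Z; apply: mmap1_eq => j; rewrite mxE.
have -> : mmap1 (fun j => ((t%:C%C *: z) 0 j)^*%C) b =
    t%:C%C ^+ m * mmap1 (fun j => (z 0 j)^*%C) b.
  rewrite -{2}bm -mmap1Z; apply: mmap1_eq => j.
  rewrite mxE; case: (z 0 j) => p q; apply/eqP; rewrite eq_complex /=.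
  by apply/andP; split; apply/eqP; ring.
by rewrite mul2n -addnn exprD rmorphM !rmorphXn /=; ring.
Qed.

Lemma hnormE (R : realType) (n : nat) (z : 'rV[R[i]]_n) :
  hnorm z = Num.sqrt (sqnorm (z 0)).
Proof. by []. Qed.

Lemma sqnorm_ge0 (R : realType) (n : nat) (z : 'I_n -> R[i]) : 0 <= sqnorm z.
Proof. by apply: sumr_ge0 => j _; exact: sqr_ge0. Qed.

(** Scaling reduces to the unit sphere; at [z = 0] both sides vanish because [m > 0]. *)
Lemma biform_min_le (R : realType) (n m : nat)
    (c : multinom n -> multinom n -> R[i]) (z : 'rV[R[i]]_n) :
  (0 < n)%N -> (0 < m)%N ->
  biform_min m c * sqnorm (z 0) ^+ m <= complex.Re (biform m c z).
Proof.
move=> n0 m0; have [_ Hmin] := biform_min_attained m c n0.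
have [s0|s0] := eqVneq (sqnorm (z 0)) 0.
  have -> : z = 0%:C%C *: z.
    apply/rowP => j; rewrite !mxE mul0r; apply: Normc.eq0_normc.
    apply/eqP; rewrite -sqrf_eq0; apply/eqP.
    by apply: (psumr_eq0P _ s0) => // i _; exact: sqr_ge0.
  rewrite biformZ expr0n muln_eq0 /= eqn0Ngt m0 mul0r /=.
  have -> : sqnorm ((0%:C%C *: z) 0) = 0.
    by rewrite /sqnorm big1 // => j _; rewrite mxE mul0r Normc.normc0 expr0n.
  by rewrite expr0n eqn0Ngt m0 mulr0.
have sp : 0 < sqnorm (z 0) by rewrite lt_neqAle eq_sym s0 sqnorm_ge0.
pose t := Num.sqrt (sqnorm (z 0)).
have tp : 0 < t by rewrite sqrtr_gt0.
have t2 : t ^+ 2 = sqnorm (z 0) by rewrite sqr_sqrtr // ltW.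
pose y := (t^-1)%:C%C *: z.
have zE : z = t%:C%C *: y.
  by rewrite /y scalerA -rmorphM mulfV ?gt_eqF // scale1r.
have ny : hnorm y = 1.
  rewrite hnormE (_ : sqnorm (y 0) = 1) ?sqrtr1 //.
  rewrite /sqnorm (eq_bigr (fun j => t ^- 2 * Normc.normc (z 0 j) ^+ 2)).
    by rewrite -mulr_sumr -/(sqnorm (z 0)) -t2 mulVf // expf_neq0 // gt_eqF.
  move=> j _; rewrite mxE Normc.normcM exprMn; congr (_ * _).
  by rewrite /= expr0n addr0 sqrtr_sqr real_normK ?num_real // exprVn.
rewrite {2}zE biformZ -t2 -exprM.
have -> : complex.Re ((t ^+ (2 * m))%:C%C * biform m c y) =
    t ^+ (2 * m) * complex.Re (biform m c y).
  by case: (biform m c y) => p q /=; rewrite mul0r subr0.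
by rewrite mulrC ler_wpM2l ?exprn_ge0 ?(ltW tp) // Hmin.
Qed.

(** [contraction_bound] for the zero multi-index at a minimising unit vector. It gives Lambda/lambda
    >= 1, so that the one bound on [N] yields both bounds of [gram_ge0]. *)
Lemma biform_min_le_norm (R : realType) (n m : nat)
    (c : multinom n -> multinom n -> R[i]) :
  (0 < n)%N -> biform_min m c <= biform_norm m c.
Proof.
move=> n0; have [[z hz <-] _] := biform_min_attained m c n0.
have sz : sqnorm (z 0) = 1.
  by rewrite -[LHS]sqr_sqrtr ?sqnorm_ge0 // -hnormE hz expr1n.
have := @contraction_bound R n m c mnm0 (z 0); rewrite mdeg0 => /(_ isT).
rewrite sz expr1n muln0 expn0 !mulr1 => h; apply: le_trans h.
apply: le_trans (ler_norm _) _; rewrite le_eqVlt; apply/orP; left; apply/eqP.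
congr (`|complex.Re _|); rewrite biformE; apply: eq_bigr => a _; apply: eq_bigr => b _.
have b0 x : @mbin n x mnm0 = 1%N by rewrite /mbin big1 // => j _; rewrite mnm0E bin0.
by rewrite mfact0 !b0 mulr1 !subm0.
Qed.

(** * Choice of the constant and assembly of the squares *)

Theorem theorem2 (R : realType) :
  exists C : R, 0 < C /\
    forall (n m : nat), (2 <= n)%N -> (1 <= m)%N ->
    forall c : multinom n -> multinom n -> R[i],
    (forall z : 'rV[R[i]]_n, z != 0 -> 0 < biform m c z) ->
    forall N : nat,
    C * (biform_norm m c / biform_min m c) * (m + n)%:R ^+ 3 * ln n%:R ^+ 3
      <= N%:R ->
    exists P : 'I_(homog_dim R[i] n (m + N)) -> dhomog n R[i] (m + N),
    forall z : 'rV[R[i]]_n,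
      ((hnorm z) ^+ (2 * N))%:C%C * biform m c z
      = \sum_(j < homog_dim R[i] n (m + N)) `|meval (z 0) (P j)| ^+ 2.
Proof.
have ln2 : 0 < ln (2 : R) by rewrite ln_gt0 // ltr1n.
exists (2 / ln 2 ^+ 3); split; first by rewrite divr_gt0 // exprn_gt0.
case=> // n m n2 m1 c Hpos N HN.
set lam := biform_min m c in HN; set L := biform_norm m c in HN.
(* The minimum is attained at a unit vector, so strict positivity of the form passes to [lam]. *)
have lam0 : 0 < lam.
  have [[z hz hE] _] := @biform_min_attained R n.+1 m c isT.
  have : 0 < biform m c z.
    apply: Hpos; apply/eqP => z0; move: hz; rewrite z0 hnormE /sqnorm big1.
      by rewrite sqrtr0 => /eqP; rewrite eq_sym oner_eq0.
    by move=> j _; rewrite mxE Normc.normc0 expr0n.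
  by rewrite ltcE hE => /andP[].
have lamL : lam <= L by exact: biform_min_le_norm.
have q1 : 1 <= L / lam by rewrite ler_pdivlMr // mul1r.
have q0 : 0 <= L / lam by exact: le_trans q1.
have HN1 : 2 * (L / lam) * (n.+1%:R * m%:R ^+ 2) <= N%:R.
  apply: le_trans HN.
  have -> : 2 / ln 2 ^+ 3 * (L / lam) * (m + n.+1)%:R ^+ 3 * ln n.+1%:R ^+ 3 =
    2 * (L / lam) * ((m + n.+1)%:R ^+ 3 * (ln n.+1%:R / ln 2) ^+ 3).
    by field; rewrite ?gt_eqF.
  apply: ler_wpM2l; first by apply: mulr_ge0.
  rewrite -[X in X <= _]mulr1; apply: ler_pM; rewrite ?ler01 //.
  - rewrite -!natrX -natrM ler_nat.
    apply: (@leq_trans ((m + n.+1) * (m + n.+1) ^ 2)); last by rewrite -expnS.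
    by apply: leq_mul; rewrite ?leq_addl // leq_exp2r // leq_addr.
  - apply: exprn_ege1; rewrite ler_pdivlMr // mul1r ler_ln ?posrE ?ltr0n //.
    by rewrite ler_nat.
have nm0 : 0 <= n.+1%:R * m%:R ^+ 2 :> R by rewrite mulr_ge0 ?sqr_ge0.
have HN2 : 2 * (n.+1%:R * m%:R ^+ 2) <= N%:R :> R.
  apply: le_trans HN1; rewrite -mulrA ler_wpM2l // -[X in X <= _]mul1r.
  by rewrite ler_wpM2r.
have HN3 : 2 * (n.+1%:R * m%:R ^+ 2) * L <= N%:R * lam.
  rewrite -ler_pdivrMr //; apply: le_trans HN1.
  by rewrite le_eqVlt; apply/orP; left; apply/eqP; ring.
have N0 : (0 < N)%N.
  rewrite -(ltr0n R); apply: lt_le_trans HN2.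
  by rewrite !mulr_gt0 ?ltr0n ?exprn_gt0 ?ltr0n.
have [B [uB sB BE]] := homog_monomials n (m + N).
have dB : size B = homog_dim R[i] n.+1 (m + N) by rewrite sB homog_dimE.
pose hom := [seq a : bmultinom n.+1 m.+1 <- index_enum (bmultinom n.+1 m.+1) | mdeg a == m].
(* The terms of |z|^(2N) f: a word [w] and a pair [(a, b)] stand for the monomial z^(a+w)
   conj(z)^(b+w). *)
pose r := [seq (w, ab) | w <- words n.+1 N, ab <- [seq (a, b) | a <- hom, b <- hom]].
have rE (F : multinom n.+1 * (bmultinom n.+1 m.+1 * bmultinom n.+1 m.+1) -> R[i]) :
    \sum_(t <- r) F t = \sum_(w <- words n.+1 N)
      \sum_(a : bmultinom n.+1 m.+1 | mdeg a == m)
        \sum_(b : bmultinom n.+1 m.+1 | mdeg b == m) F (w, (a, b)).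
  rewrite big_allpairs_dep; apply: eq_bigr => w _.
  rewrite big_allpairs_dep big_filter; apply: eq_bigr => a _.
  by rewrite big_filter.
have rB t : t \in r -> (mnm_add (bmnm t.2.1) t.1 \in B) && (mnm_add (bmnm t.2.2) t.1 \in B).
  case/allpairsP=> -[w ab] /= [/mdeg_words dw /allpairsP[[a b] /= [ha hb ->]] ->] /=.
  move: ha hb; rewrite !mem_filter => /andP[/eqP da _] /andP[/eqP db _].
  by rewrite !BE !mdegD dw da db eqxx.
have Hgram V : 0 <= complex.Re (\sum_(t <- r) c t.2.1 t.2.2 *
    (V (mnm_add (bmnm t.2.2) t.1) * (V (mnm_add (bmnm t.2.1) t.1))^*%C)).
  rewrite rE /=; apply: (gram_ge0 (lam := lam) (B := B)) => //.
  move=> z; have := @biform_min_le R n.+1 m c (\row_j z j) isT m1.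
  rewrite biformE -/lam.
  have -> : sqnorm ((\row_j z j) 0) = sqnorm z.
    by apply: eq_bigr => j _; rewrite mxE.
  move=> /le_trans; apply; rewrite le_eqVlt; apply/orP; left; apply/eqP.
  congr complex.Re; apply: eq_bigr => a _; apply: eq_bigr => b _.
  by congr (_ * (_ * _)); apply: mmap1_eq => j; rewrite mxE.
have [p Hp] := gram_squares uB rB Hgram.
rewrite dB in p Hp.
have BX (i : 'I_(homog_dim R[i] n.+1 (m + N))) :
    mpolyX R[i] (nth mnm0 B i) \is ishomog1 (m + N) mdeg.
  by rewrite dhomogX -BE mem_nth // dB.
(* The Gram form conjugates [V] at [a + w], whereas z^(a+w) appears unconjugated. So it is evaluated
   at V x = conj(z^x), and conjugating inside the modulus gives holomorphic polynomials with
   conjugate coefficients. *)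
exists (fun l => \sum_i (p l i)^*%C *: DHomog (BX i)) => z.
have -> : (hnorm z ^+ (2 * N))%:C%C * biform m c z =
    (complex.Re (\sum_(t <- r) c t.2.1 t.2.2 *
      ((mmap1 (z 0) (mnm_add (bmnm t.2.2) t.1))^*%C *
       ((mmap1 (z 0) (mnm_add (bmnm t.2.1) t.1))^*%C)^*%C)))%:C%C.
  have -> : \sum_(t <- r) c t.2.1 t.2.2 *
      ((mmap1 (z 0) (mnm_add (bmnm t.2.2) t.1))^*%C *
       ((mmap1 (z 0) (mnm_add (bmnm t.2.1) t.1))^*%C)^*%C) =
       (sqnorm (z 0) ^+ N)%:C%C * biform m c z.
    rewrite rE -sqnormE mulr_suml; apply: eq_bigr => w _.
    rewrite biformE mulr_sumr; apply: eq_bigr => a _.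
    rewrite mulr_sumr; apply: eq_bigr => b _ /=.
    by rewrite conjcK !mmap1_conj !mmap1D rmorphM /=; ring.
  rewrite exprM hnormE sqr_sqrtr ?sqnorm_ge0 //.
  (* The squares represent a real part only. The order on [R[i]] makes the positive values real; at
     0 the form vanishes by homogeneity. *)
  have Fr : complex.Im (biform m c z) = 0.
    have [->|z0] := eqVneq z 0; last first.
      by have := Hpos z z0; rewrite ltcE => /andP[/eqP].
    have := @biformZ R n.+1 m c 0 0; rewrite scaler0 expr0n muln_eq0 /= eqn0Ngt m1 /=.
    by rewrite mul0r => ->.
  case: (biform m c z) Fr => x y /= ->.
  by apply/eqP; rewrite eq_complex /=; apply/andP; split; apply/eqP; ring.
rewrite (Hp (fun x => (mmap1 (z 0) x)^*%C)); apply: eq_bigr => l _.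
congr (_ ^+ 2); rewrite -[LHS]norm_conjC; congr (`|_|).
rewrite !raddf_sum /=; apply: eq_bigr => i _.
by rewrite linearZ /= /meval mmapX rmorphM /=; congr (_ * _); exact: conjcK.
Qed.
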